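(* Let $U_1,U_2\in O_\epsilon(U_{m1})$ and $U_3\in O_\epsilon(U_{m2})$ with $$\{U_1,U_2\}=(0,\alpha_2,\alpha_3,\alpha_4)\qquad\text{and}\qquad \{U_2,U_3\}=(\beta_1,\sigma_2,\sigma_3,0).$$ Then there is a unique $(\delta_1,\sigma_2',\sigma_3',\delta_4)$ such that $\{U_1,U_3\}=(\delta_1,\sigma_2',\sigma_3',\delta_4)$, and $$\delta_1=\beta_1+K_{vb1}\alpha_4+O(1)\Delta',\qquad \sigma_2'=\sigma_2+\alpha_2+K_{vb2}\alpha_4+O(1)\Delta',$$ $$\sigma_3'=\sigma_3+\alpha_3+K_{vb3}\alpha_4+O(1)\Delta',\qquad \delta_4=K_{vb4}\alpha_4+O(1)\Delta',$$ with $$\Delta'=|\beta_1|(|\alpha_2|+|\alpha_3|),\qquad |K_{vb1}|<1,\qquad \sum_{j=2}^4|K_{vbj}|\le M.$$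
   Context: Fix $\gamma>1$. For $U=(u,v,p,\rho)$ with $p,\rho>0$ put $c=\sqrt{\gamma p/\rho}$, $h=\frac{\gamma p}{(\gamma-1)\rho}$, $$W(U)=\big(\rho u,\rho u^2+p,\rho uv,\rho u(h+\tfrac{u^2+v^2}{2})\big),\quad H(U)=\big(\rho v,\rho uv,\rho v^2+p,\rho v(h+\tfrac{u^2+v^2}{2})\big).$$ The steady full Euler system is $W(U)_x+H(U)_y=0$. For $u>c$ its eigenvalues are $\lambda_j=\frac{uv+(-1)^jc\sqrt{u^2+v^2-c^2}}{u^2-c^2}$ ($j=1,4$), $\lambda_2=\lambda_3=v/u$, with eigenvectors $\mathbf r_j=\kappa_j(-\lambda_j,1,\rho(\lambda_ju-v),\rho(\lambda_ju-v)/c^2)^\top$ ($j=1,4$, $\kappa_j$ chosen so that $\mathbf r_j\cdot\nabla\lambda_j=1$), $\mathbf r_2=(u,v,0,0)^\top$, $\mathbf r_3=(0,0,0,\rho)^\top$. Elementary waves. For $j=1,4$, $\alpha\mapsto\Phi_j(\alpha;U)$ is a fixed (Lax) $C^2$ parametrization of the states that lie above a state $U$ and are connected to it by a $j$-rarefaction wave ($\alpha>0$) or by a $j$-shock ($\alpha<0$) satisfying the Rankine–Hugoniot conditions $s(W(U_+)-W(U_-))=H(U_+)-H(U_-)$ and $\lambda_j(U_+)<s<\lambda_j(U_-)$ ($-$ below, $+$ above), with $\Phi_j(0;U)=U$, $\partial_\alpha\Phi_j(0;U)=\mathbf r_j(U)$. Vortex sheets and entropy waves: $\Phi_2(\alpha;U)=(ue^\alpha,ve^\alpha,p,\rho)$,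 $\Phi_3(\alpha;U)=(u,v,p,\rho e^\alpha)$. Put $\Phi(\alpha_4,\alpha_3,\alpha_2,\alpha_1;U)=\Phi_4(\alpha_4;\Phi_3(\alpha_3;\Phi_2(\alpha_2;\Phi_1(\alpha_1;U))))$ and $G_{2,3}(\sigma_3,\sigma_2;U)=\Phi_3(\sigma_3;\Phi_2(\sigma_2;U))$. Background states. $U_{m1}=(u_{m1},0,p_{m1},\rho_{m1})$ and $U_{m2}=(u_{m2},0,p_{m2},\rho_{m2})$ are fixed, both with $u>c$, connected by a strong combined vortex sheet/entropy wave: $U_{m2}=G_{2,3}(\sigma_{30},\sigma_{20};U_{m1})$. Notation. For two states near the same background state, $\{U,V\}=(\alpha_1,\alpha_2,\alpha_3,\alpha_4)$ means $V=\Phi(\alpha_4,\alpha_3,\alpha_2,\alpha_1;U)$ with small $\alpha_i$. For $U$ near $U_{m1}$ and $V$ near $U_{m2}$, $\{U,V\}=(\delta_1,\sigma_2,\sigma_3,\delta_4)$ means $V=\Phi_4(\delta_4;G_{2,3}(\sigma_3,\sigma_2;\Phi_1(\delta_1;U)))$ with $\delta_1,\delta_4$ near $0$ and $(\sigma_2,\sigma_3)$ near $(\sigma_{20},\sigma_{30})$. $O_\epsilon(\cdot)$ denotes sufficiently small neighborhoods, $M>0$ a large constant, both depending only on the system and the background states; $O(1)$ denotes a quantity bounded in absolute value by $M$; uniqueness is within these parameter neighborhoods. The coefficients $K$ may depend on the given states and wave strengths. *)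

(* Defs.v *)
From HB Require Import structures.
From mathcomp Require Import all_boot all_order all_algebra.
From mathcomp Require Import all_classical all_reals all_analysis.

Set Implicit Arguments.
Unset Strict Implicit.
Unset Printing Implicit Defensive.

Import Order.TTheory GRing.Theory Num.Theory.
Import numFieldNormedType.Exports.

Local Open Scope classical_set_scope.
Local Open Scope ring_scope.

Section EulerSystem.
Context {R : realType}.

(* A state U = (u, v, p, rho) is a row vector. *)
Definition mkstate (u v p rho : R) : 'rV[R]_4 :=
  \row_i [:: u; v; p; rho]`_i.

Definition velu (U : 'rV[R]_4) : R := U 0 0.
Definition velv (U : 'rV[R]_4) : R := U 0 1.
Definition pres (U : 'rV[R]_4) : R := U 0 2%:R.
Definition dens (U : 'rV[R]_4) : R := U 0 3%:R.

Variable gamma : R.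

Definition sound (U : 'rV[R]_4) : R := Num.sqrt (gamma * pres U / dens U).

Definition enthalpy (U : 'rV[R]_4) : R :=
  gamma * pres U / ((gamma - 1) * dens U).

Definition fluxW (U : 'rV[R]_4) : 'rV[R]_4 :=
  let u := velu U in let v := velv U in
  let p := pres U in let rho := dens U in
  mkstate (rho * u) (rho * u ^+ 2 + p) (rho * u * v)
          (rho * u * (enthalpy U + (u ^+ 2 + v ^+ 2) / 2)).

Definition fluxH (U : 'rV[R]_4) : 'rV[R]_4 :=
  let u := velu U in let v := velv U in
  let p := pres U in let rho := dens U in
  mkstate (rho * v) (rho * u * v) (rho * v ^+ 2 + p)
          (rho * v * (enthalpy U + (u ^+ 2 + v ^+ 2) / 2)).

Definition supersonic (U : 'rV[R]_4) : Prop :=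
  [/\ 0 < pres U, 0 < dens U & sound U < velu U].

(* Only meaningful for the genuinely nonlinear families j = 1 and j = 4. *)
Definition lambda (j : nat) (U : 'rV[R]_4) : R :=
  let u := velu U in let v := velv U in let c := sound U in
  (u * v + (-1) ^+ j * c * Num.sqrt (u ^+ 2 + v ^+ 2 - c ^+ 2))
    / (u ^+ 2 - c ^+ 2).

Definition eigendir (j : nat) (U : 'rV[R]_4) : 'rV[R]_4 :=
  let a := dens U * (lambda j U * velu U - velv U) in
  mkstate (- lambda j U) 1 a (a / sound U ^+ 2).

(* Normalization: r_j . grad lambda_j = 1. *)
Definition kappa (j : nat) (U : 'rV[R]_4) : R :=
  ('D_(eigendir j U) (lambda j) U)^-1.

Definition eigenvec (j : nat) (U : 'rV[R]_4) : 'rV[R]_4 :=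
  kappa j U *: eigendir j U.

(* [V], above, is joined to [U], below, by a [j]-rarefaction wave: it lies on
   the integral curve of r_j issued from [U], in the direction of increasing
   lambda_j. *)
Definition rarefaction (j : nat) (U V : 'rV[R]_4) : Prop :=
  exists (t : R) (g : R -> 'rV[R]_4),
    [/\ 0 < t, g 0 = U, g t = V &
        forall s : R, 0 <= s <= t ->
          supersonic (g s) /\ is_derive s 1 g (eigenvec j (g s))].

(* [V], above, is joined to [U], below, by a [j]-shock. *)
Definition shock (j : nat) (U V : 'rV[R]_4) : Prop :=
  [/\ supersonic U, supersonic V &
      exists s : R, s *: (fluxW V - fluxW U) = fluxH V - fluxH U /\
                    lambda j V < s < lambda j U].

Definition C2_near {V W : normedModType R} (f : V -> W) (x0 : V) : Prop :=
  \forall x \near x0,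
    [/\ differentiable f x,
        forall v, differentiable ('D_v f) x &
        forall v w, {for x, continuous ('D_w ('D_v f))}].

(* [Phi a U] is a parametrization, for [a] near 0 and [U] near [U0], of the
   [j]-wave curve issued from [U]. The last two clauses say that every state
   close to [U] that can be joined to it by a [j]-wave is reached. *)
Definition lax_curve (j : nat) (Phi : R -> 'rV[R]_4 -> 'rV[R]_4)
    (U0 : 'rV[R]_4) : Prop :=
  [/\ C2_near (fun x : R * 'rV[R]_4 => Phi x.1 x.2) (0, U0),
      \forall U \near U0,
        Phi 0 U = U /\ is_derive (0 : R) 1 (Phi ^~ U) (eigenvec j U),
      \forall x \near ((0 : R), U0),
        (0 < x.1 -> rarefaction j x.2 (Phi x.1 x.2)) /\
        (x.1 < 0 -> shock j x.2 (Phi x.1 x.2)),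
      forall e : R, 0 < e -> \forall x \near (U0, U0), rarefaction j x.1 x.2 ->
        exists2 a, 0 < a < e & x.2 = Phi a x.1 &
      forall e : R, 0 < e -> \forall x \near (U0, U0), shock j x.1 x.2 ->
        exists2 a, - e < a < 0 & x.2 = Phi a x.1].

Definition Phi2 (a : R) (U : 'rV[R]_4) : 'rV[R]_4 :=
  mkstate (velu U * expR a) (velv U * expR a) (pres U) (dens U).

Definition Phi3 (a : R) (U : 'rV[R]_4) : 'rV[R]_4 :=
  mkstate (velu U) (velv U) (pres U) (dens U * expR a).

Definition G23 (s3 s2 : R) (U : 'rV[R]_4) : 'rV[R]_4 := Phi3 s3 (Phi2 s2 U).

Variables Phi1 Phi4 : R -> 'rV[R]_4 -> 'rV[R]_4.

Definition wave_comp (a4 a3 a2 a1 : R) (U : 'rV[R]_4) : 'rV[R]_4 :=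
  Phi4 a4 (Phi3 a3 (Phi2 a2 (Phi1 a1 U))).

(* {U, V} = a for U, V near the same background state, with parameters in the
   neighborhood of size eta of 0. *)
Definition weak_waves (eta : R) (U V : 'rV[R]_4) (a : R * R * R * R) : Prop :=
  let: (a1, a2, a3, a4) := a in
  [/\ `|a1| < eta, `|a2| < eta, `|a3| < eta, `|a4| < eta &
      V = wave_comp a4 a3 a2 a1 U].

(* {U, V} = d across the strong vortex sheet / entropy wave, with parameters in
   the neighborhood of size eta of (0, s20, s30, 0). *)
Definition strong_waves (s20 s30 eta : R) (U V : 'rV[R]_4)
    (d : R * R * R * R) : Prop :=
  let: (d1, s2, s3, d4) := d in
  [/\ `|d1| < eta, `|s2 - s20| < eta, `|s3 - s30| < eta, `|d4| < eta &
      V = Phi4 d4 (G23 s3 s2 (Phi1 d1 U))].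

End EulerSystem.

(* Main.v *)
(** Crossing the strong sheet, the strengths [d = (d1, s2', s3', d4)] solve
    [F(d, U1) = U3], where [F(d, U) = Phi4 d4 (G23 s3' s2' (Phi1 d1 U))].  At the
    background state [F] is strictly differentiable in [d], and its derivative
    [A] is invertible: the 2- and 3-directions only move [u] and [rho], while
    the (v, p)-components of [r1] and [r4] are independent.  A Newton iteration
    gives existence, strict differentiability gives uniqueness.

    The guess [d* = (b1, s2 + a2, s3 + a3, 0)] is exact when [a4 = 0] and either
    [b1 = 0] or [a2 = a3 = 0].  In general [U3 - F(d*, U1)] is the sum of
    [a4 G23 s30 s20 r4(Um1)], of [o(a4)], and of the commutator of [Phi1 b1] with
    the linear map [G23 a3 a2], which is [O(|b1| (|a2| + |a3|))] since the mixed
    second derivatives of [Phi1] are bounded.  Applying [A^-1], [d - d*] is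
    [a4 X] up to small terms.  The first entry of [X] is a reflection coefficient
    [(P - Q) / (P + Q)] with [P, Q > 0], because [kappa_1 = kappa_4] when
    [v = 0]; hence it is less than 1 in absolute value. *)
Require Import Defs.
From HB Require Import structures.
From mathcomp Require Import all_boot all_order all_algebra.
From mathcomp Require Import all_classical all_reals all_analysis.
From mathcomp Require Import ring lra.
Set Implicit Arguments.
Unset Strict Implicit.
Unset Printing Implicit Defensive.
Import Order.TTheory GRing.Theory Num.Theory.
Import numFieldNormedType.Exports.
Local Open Scope classical_set_scope.
Local Open Scope ring_scope.

(** * Mean value estimates and strict differentiability of C1 maps *)

Section StrictDerivative.
Context {R : realType}.

Lemma rV_norm_le n (x : 'rV[R]_n) (e : R) :
  0 <= e -> (forall i, `|x 0 i| <= e) -> `|x| <= e.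
Proof.
move=> e0 H; rewrite [leLHS]/Num.Def.normr/= mx_normrE.
by rewrite (bigmax_le _ e0)// => -[i j] _ /=; rewrite ord1.
Qed.

Lemma rV_coord_le n (x : 'rV[R]_n) i : `|x 0 i| <= `|x|.
Proof.
rewrite [leRHS]/Num.Def.normr/= mx_normrE.
exact: (le_bigmax _ (fun i : 'I_1 * 'I_n => `|x i.1 i.2|) (0, i)).
Qed.

Lemma near_normP (V : normedModType R) (x0 : V) (P : V -> Prop) :
  (\forall x \near x0, P x) ->
  exists2 r, 0 < r & forall x, `|x - x0| < r -> P x.
Proof.
move=> /nbhs_ballP[r /= r0 rP]; exists r => // x xr; apply: rP.
by rewrite -ball_normE /= distrC.
Qed.

Lemma pair_basis n (w : R * 'rV[R]_n) :
  w = w.1 *: (1, 0) + \sum_(i < n) w.2 0 i *: (0, delta_mx 0 i).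
Proof.
have -> : \sum_(i < n) w.2 0 i *: ((0, delta_mx 0 i) : R * 'rV[R]_n) = (0, w.2).
  rewrite [in RHS](row_sum_delta w.2).
  apply: (big_rec2 (fun a b => a = (0, b) :> R * 'rV[R]_n)) => //= i a b _ ->.
  by apply: injective_projections => /=; rewrite ?scaler0 ?addr0.
case: w => a b; apply: injective_projections => /=.
  by rewrite addr0 [_ *: 1]mulr1.
by rewrite scaler0 add0r.
Qed.

(** Continuity of ['D_v g] is available one direction [v] at a time. This expansion over finitely
    many basis directions makes it uniform in the direction. *)
Lemma derive_pair_sum n (W : normedModType R) (g : R * 'rV[R]_n -> W) w z :
  differentiable g z ->
  'D_w g z = w.1 *: 'D_(1, 0) g z +
             \sum_(i < n) w.2 0 i *: 'D_(0, delta_mx 0 i) g z.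
Proof.
move=> dg; rewrite !deriveE// {1}(pair_basis w) linearD linearZ linear_sum.
by congr (_ + _); apply: eq_bigr => i _; rewrite deriveE// linearZ.
Qed.

Lemma pair_norm_fst n (w : R * 'rV[R]_n) : `|w.1| <= `|w|.
Proof. by rewrite prod_normE le_max lexx. Qed.

Lemma pair_norm_snd n (w : R * 'rV[R]_n) : `|w.2| <= `|w|.
Proof. by rewrite prod_normE le_max lexx orbT. Qed.

Lemma derive_line (V W : normedModType R) (g : V -> W) (y w : V) (t : R) :
  differentiable g (t *: w + y) ->
  is_derive t 1 (fun s : R => g (s *: w + y)) ('D_w g (t *: w + y)).
Proof.
move=> dg; have dd : derivable g (t *: w + y) w by exact: diff_derivable.
have E : (fun h => h^-1 *: (g (h *: w + (t *: w + y)) - g (t *: w + y))) =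
   (fun h : R => h^-1 *: (g ((h *: 1 + t) *: w + y) - g (t *: w + y))).
  by apply/funext => h; rewrite [h *: 1]mulr1 scalerDl addrA.
split; first by rewrite /derivable /= -E.
by rewrite /derive /= -E.
Qed.

(* Mean value theorem on each coordinate, along the segment from [y] to [x]. *)
Lemma mean_value_rV (V : normedModType R) m (g : V -> 'rV[R]_m) (x0 : V)
    (L : V -> 'rV[R]_m) (r e : R) :
  (forall z, `|z - x0| < r -> differentiable g z /\
     forall w, `|'D_w g z - L w| <= e * `|w|) ->
  0 <= e -> forall x y, `|x - x0| < r -> `|y - x0| < r ->
  `|g x - g y - L (x - y)| <= e * `|x - y|.
Proof.
move=> H e0 x y xr yr; apply: rV_norm_le => [|i]; first by rewrite mulr_ge0.
set w := x - y.
have seg (t : R) : 0 <= t <= 1 -> `|t *: w + y - x0| < r.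
  move=> /andP[t0 t1].
  have -> : t *: w + y - x0 = t *: (x - x0) + (1 - t) *: (y - x0).
    have -> : w = (x - x0) - (y - x0) by rewrite opprB subrKA.
    by rewrite scalerBr scalerBl scale1r -[LHS]addrA -[LHS]addrA [- _ + (y - x0)]addrC.
  apply: le_lt_trans (ler_normD _ _) _; rewrite !normrZ ger0_norm//.
  rewrite (@ger0_norm _ (1 - t)) ?subr_ge0//.
  set k := Num.max `|x - x0| `|y - x0|.
  have kr : k < r by rewrite gt_max xr yr.
  have kE : k = t * k + (1 - t) * k by ring.
  apply: le_lt_trans kr; rewrite kE lerD// ler_wpM2l ?subr_ge0//.
    by rewrite le_max lexx.
  by rewrite le_max lexx orbT.
pose phi (t : R) := g (t *: w + y) 0 i.
have dphi (t : R) : 0 <= t <= 1 -> is_derive t 1 phi ('D_w g (t *: w + y) 0 i).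
  move=> /seg/H[dg _]; have [d1 d2] := derive_line dg.
  split; first by move/derivable_mxP : d1 => /(_ 0 i).
  by rewrite -d2 derive_mx// mxE.
have [||c] := @MVT R phi (fun t => 'D_w g (t *: w + y) 0 i) 0 1 ltr01.
- by move=> t; rewrite in_itv/= => /andP[t0 t1]; apply: dphi; rewrite !ltW.
- apply: derivable_within_continuous => t; rewrite in_itv/= => t01.
  by have [] := dphi _ t01.
rewrite in_itv/= => /andP[c0 c1]; rewrite subr0 mulr1 /phi scale1r scale0r add0r subrK.
move=> Dc; rewrite !mxE Dc.
have /H[_ /(_ w)] : `|c *: w + y - x0| < r by apply: seg; rewrite !ltW.
by apply: le_trans; apply: le_trans (rV_coord_le _ i); rewrite !mxE.
Qed.

(** Near [x0] each of the [n + 1] basis derivatives is within [e / n.+1] of its value at [x0], so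
    ['D_w g] is within [e * |w|] of ['D_w g x0] for every [w]. The mean value estimate turns this
    into strict differentiability. *)
Lemma strict_C1 n m (g : R * 'rV[R]_n -> 'rV[R]_m) x0 :
  (\forall x \near x0, differentiable g x) ->
  (forall v, {for x0, continuous ('D_v g)}) ->
  forall e, 0 < e -> exists2 r, 0 < r & forall x y,
    `|x - x0| < r -> `|y - x0| < r ->
    `|g x - g y - 'D_(x - y) g x0| <= e * `|x - y|.
Proof.
move=> dg cg e e0; have dg0 : differentiable g x0 := nbhs_singleton dg.
have e'0 : 0 < e / n.+1%:R by rewrite divr_gt0.
have : \forall x \near x0, differentiable g x /\
    (`|'D_(1, 0) g x0 - 'D_(1, 0) g x| < e / n.+1%:R /\
     forall i, `|'D_(0, delta_mx 0 i) g x0 - 'D_(0, delta_mx 0 i) g x|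
       < e / n.+1%:R).
  near=> x; split; [by near: x|split].
    by near: x; move/cvgrPdist_lt: (cg (1, 0)); exact.
  move=> i; move: i; near: x; apply: filter_forall => i.
  by move/cvgrPdist_lt: (cg (0, delta_mx 0 i)); exact.
move=> /near_normP[r r0 rP]; exists r => // x y xr yr.
apply: (@mean_value_rV _ _ g x0 (fun w => 'D_w g x0) r) => // [z zr|]; last exact: ltW.
have [dgz [H1 H2]] := rP _ zr; split => // w.
rewrite (derive_pair_sum w dgz) (derive_pair_sum w dg0) opprD addrACA -scalerBr -sumrB.
under eq_bigr do rewrite -scalerBr.
apply: (@le_trans _ _ (`|w| * (e / n.+1%:R) + \sum_(i < n) `|w| * (e / n.+1%:R))).
  apply: le_trans (ler_normD _ _) _; apply: lerD.
    rewrite normrZ; apply: ler_pM; [by []|by []|exact: pair_norm_fst|].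
    by apply: ltW; rewrite distrC.
  apply: le_trans (ler_norm_sum _ _ _) _; apply: ler_sum => i _.
  rewrite normrZ; apply: ler_pM; [by []|by []| |by rewrite distrC; exact: ltW (H2 i)].
  exact: le_trans (rV_coord_le _ i) (pair_norm_snd w).
have Ne : e / n.+1%:R *+ n.+1 = e by rewrite -[LHS]mulr_natr divfK ?pnatr_eq0.
by rewrite sumr_const card_ord -mulrS -mulrnAr Ne mulrC.
Unshelve. all: by end_near. Qed.

Lemma derive_bounded n m (g : R * 'rV[R]_n -> 'rV[R]_m) x0 :
  differentiable g x0 ->
  exists2 C, 0 <= C & forall w, `|'D_w g x0| <= C * `|w|.
Proof.
move=> dg; exists (`|'D_(1, 0) g x0| +
    \sum_(i < n) `|'D_(0, delta_mx 0 i) g x0|); first by rewrite addr_ge0// sumr_ge0.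
move=> w; rewrite derive_pair_sum// mulrDl mulr_suml.
apply: le_trans (ler_normD _ _) _; apply: lerD.
  by rewrite normrZ mulrC; apply: ler_wpM2l => //; exact: pair_norm_fst.
apply: le_trans (ler_norm_sum _ _ _) _; apply: ler_sum => i _.
rewrite normrZ mulrC; apply: ler_wpM2l => //.
exact: le_trans (rV_coord_le _ i) (pair_norm_snd w).
Qed.

Lemma lipschitz_C1 n m (g : R * 'rV[R]_n -> 'rV[R]_m) x0 :
  (\forall x \near x0, differentiable g x) ->
  (forall v, {for x0, continuous ('D_v g)}) ->
  exists2 C, 0 <= C & exists2 r, 0 < r & forall x y,
    `|x - x0| < r -> `|y - x0| < r -> `|g x - g y| <= C * `|x - y|.
Proof.
move=> dg cg; have dg0 : differentiable g x0 := nbhs_singleton dg.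
have [C C0 HC] := derive_bounded dg0.
have [r r0 H] := strict_C1 dg cg ltr01.
exists (1 + C); first by rewrite addr_ge0.
exists r => // x y xr yr; rewrite -[g x - g y](subrK ('D_(x - y) g x0)) mulrDl.
by apply: le_trans (ler_normD _ _) _; rewrite lerD// H.
Qed.

End StrictDerivative.

(** * First-order and mixed second-order estimates for wave curves *)

Section LaxCurve.
Context {R : realType}.
Variables (gamma : R) (j : nat) (Phi : R -> 'rV[R]_4 -> 'rV[R]_4) (U0 : 'rV[R]_4).
Hypothesis lax : lax_curve gamma j Phi U0.

Let f (x : R * 'rV[R]_4) := Phi x.1 x.2.

Lemma lax_curve_id :
  exists2 r, 0 < r & forall U, `|U - U0| < r -> Phi 0 U = U.
Proof.
case: lax => _ + _ _ _ => /near_normP[r r0 H].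
by exists r => // U /H[].
Qed.

(** The differential at [(0, U0)] is split by linearity: along the strength it is the prescribed
    tangent, and along the state it is the identity because [Phi 0] is the identity near [U0]. *)
Lemma lax_curve_derive a b :
  'D_(a, b) f (0, U0) = a *: eigenvec gamma j U0 + b.
Proof.
case: (lax) => + H1 _ _ _ => /nbhs_singleton[df _ _].
have df0 : differentiable f (0, U0) by [].
have -> : (a, b) = a *: (1, 0) + (0, b) :> R * 'rV[R]_4.
  by apply: injective_projections => /=;
    rewrite ?addr0 ?scaler0 ?add0r// [_ *: 1]mulr1.
rewrite deriveE// linearD linearZ -!deriveE//; congr (_ *: _ + _).
  have [_ [_ <-]] := nbhs_singleton H1.
  rewrite /derive; apply: (congr1 (fun g : R -> 'rV[R]_4 => lim (g @ 0^'))).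
  apply/funext => h /=.
  by rewrite /f /= scaler0 add0r.
have -> : 'D_(0, b) f (0, U0) = 'D_b (Phi 0) U0.
  rewrite /derive; apply: (congr1 (fun g : R -> 'rV[R]_4 => lim (g @ 0^'))).
  apply/funext => h /=.
  by rewrite /f /= scaler0 add0r.
have E : \near U0, Phi 0 U0 = id U0 by apply: filterS H1 => U [].
by rewrite (near_eq_derive _ E) derive_id.
Qed.

Lemma lax_curve_strict e : 0 < e ->
  exists2 r, 0 < r & forall t t' U U',
    `|t| < r -> `|t'| < r -> `|U - U0| < r -> `|U' - U0| < r ->
    `|Phi t U - Phi t' U' - ((t - t') *: eigenvec gamma j U0 + (U - U'))|
      <= e * (`|t - t'| + `|U - U'|).
Proof.
move=> e0; case: (lax) => C2 _ _ _ _.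
have [||r r0 H] := @strict_C1 R 4 4 f (0, U0) _ _ e e0.
- by apply: filterS C2 => x [].
- move=> v; apply: differentiable_continuous.
  by have [_ H _] := nbhs_singleton C2; exact: H.
exists r => // t t' U U' tr t'r Ur U'r.
have := H (t, U) (t', U').
rewrite lax_curve_derive /f /= => /(_ _ _)/le_trans; apply.
- by rewrite prod_normE/= subr0 gt_max tr.
- by rewrite prod_normE/= subr0 gt_max t'r.
rewrite ler_pM2l// prod_normE ge_max/= lerDl lerDr !normr_ge0//.
Qed.

(** The strength derivative of [Phi] is itself C1 by the second-order hypothesis, hence Lipschitz in
    the state; the mean value estimate in [b] supplies the factor [|b|]. This is where bounded
    second derivatives enter. *)
Lemma lax_curve_mixed :
  exists2 C, 0 <= C & exists2 r, 0 < r & forall b U U',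
    `|b| < r -> `|U - U0| < r -> `|U' - U0| < r ->
    `|Phi b U - Phi 0 U - (Phi b U' - Phi 0 U')| <= C * `|b| * `|U - U'|.
Proof.
case: (lax) => C2 _ _ _ _.
have [||C C0 [r r0 H]] := @lipschitz_C1 R 4 4 ('D_(1, 0) f) (0, U0).
- by apply: filterS C2 => x [].
- by move=> v; have [_ _] := nbhs_singleton C2; exact.
have /near_normP[r' r'0 dfr] : \forall x \near (0, U0), differentiable f x.
  by apply: filterS C2 => x [].
exists C => //; exists (Num.min r r'); first by rewrite lt_min r0.
move=> b U U'; rewrite !lt_min => /andP[br br'] /andP[Ur Ur'] /andP[U'r U'r'].
have near_pair (s : R) (V : 'rV[R]_4) (d : R) : `|s| < d -> `|V - U0| < d ->
    `|(s, V) - (0, U0)| < d.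
  by move=> sd Vd; rewrite prod_normE gt_max/= subr0 sd.
have dline (s : R) V : `|s| < r' -> `|V - U0| < r' ->
    is_derive s 1 (fun s => Phi s V) ('D_(1, 0) f (s, V)).
  move=> sr' Vr'.
  have E (z : R) : (z, V) = z *: (1, 0) + (0, V).
    by apply: injective_projections => /=;
      rewrite ?addr0 ?scaler0 ?add0r// [_ *: 1]mulr1.
  have := @derive_line R _ _ f (0, V) (1, 0) s.
  rewrite -E => /(_ (dfr _ (near_pair _ _ _ sr' Vr'))).
  by under eq_fun do rewrite -E.
(* Regrouped as the increment of [s |-> Phi s U - Phi s U'] between [0] and [b]. The trailing [0] is
   the zero linear map with which the mean value estimate is applied. *)
have -> : Phi b U - Phi 0 U - (Phi b U' - Phi 0 U') =
    Phi b U - Phi b U' - (Phi 0 U - Phi 0 U') - 0.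
  rewrite subr0 !opprB -!addrA; congr (_ + _).
  by rewrite [LHS]addrCA [RHS]addrCA; congr (_ + _); rewrite addrC.
rewrite mulrAC -[X in _ <= _ * `|X|](subr0 b).
have m0 : 0 < Num.min r r' by rewrite lt_min r0.
have CU0 : 0 <= C * `|U - U'| by rewrite mulr_ge0.
apply: (@mean_value_rV R R 4 (fun s => Phi s U - Phi s U') 0 (fun=> 0)
  (Num.min r r')) => // [s||]; last 2 first.
- by rewrite subr0 lt_min br.
- by rewrite subr0 normr0.
rewrite subr0 lt_min => /andP[sr sr'].
have dU := dline _ _ sr' Ur'; have dU' := dline _ _ sr' U'r'.
have dUU' := is_deriveB dU dU'.
have dd : differentiable (fun s => Phi s U - Phi s U') s.
  by apply/derivable1_diffP; case: dUU'.
split => // w; rewrite subr0 deriveE//.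
have -> : 'd (fun s => Phi s U - Phi s U') s w =
    w *: 'd (fun s => Phi s U - Phi s U') s 1.
  by rewrite -linearZ [_ *: 1]mulr1.
rewrite -deriveE//.
rewrite (@derive_val _ _ _ _ _ _ _ dUU') normrZ mulrC.
apply: ler_wpM2r => //.
have := H (s, U) (s, U') (near_pair _ _ _ sr Ur) (near_pair _ _ _ sr U'r).
move=> /le_trans; apply; apply: ler_wpM2l => //.
by rewrite prod_normE/= subrr normr0 ge_max lexx normr_ge0.
Qed.


End LaxCurve.

(** * Acoustic eigenvectors at a state with v = 0 *)

Section BackgroundEigen.
Context {R : realType}.
Variable gamma : R.
Hypothesis gamma_gt1 : 1 < gamma.

Lemma mkstateE (u v p rho : R) :
  (velu (mkstate u v p rho) = u) * (velv (mkstate u v p rho) = v) *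
  (pres (mkstate u v p rho) = p) * (dens (mkstate u v p rho) = rho).
Proof. by rewrite /velu /velv /pres /dens !mxE. Qed.

Lemma stateP (U V : 'rV[R]_4) : velu U = velu V -> velv U = velv V ->
  pres U = pres V -> dens U = dens V -> U = V.
Proof.
rewrite /velu /velv /pres /dens => E0 E1 E2 E3; apply/rowP => -[[|[|[|[|//]]]] i].
- by rewrite (_ : Ordinal i = 0)//; exact: val_inj.
- by rewrite (_ : Ordinal i = 1)//; exact: val_inj.
- by rewrite (_ : Ordinal i = 2%:R)//; exact: val_inj.
- by rewrite (_ : Ordinal i = 3%:R)//; exact: val_inj.
Qed.

Lemma state_norm_le (U : 'rV[R]_4) (e : R) : `|velu U| <= e -> `|velv U| <= e ->
  `|pres U| <= e -> `|dens U| <= e -> `|U| <= e.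
Proof.
rewrite /velu /velv /pres /dens => E0 E1 E2 E3; apply: rV_norm_le => [|[[|[|[|[|//]]]] i]].
- exact: le_trans E0.
- by rewrite (_ : Ordinal i = 0)//; exact: val_inj.
- by rewrite (_ : Ordinal i = 1)//; exact: val_inj.
- by rewrite (_ : Ordinal i = 2%:R)//; exact: val_inj.
- by rewrite (_ : Ordinal i = 3%:R)//; exact: val_inj.
Qed.

Lemma sound_gt0 U : supersonic gamma U -> 0 < sound gamma U.
Proof.
move=> [p0 r0 _]; rewrite sqrtr_gt0 divr_gt0// mulr_gt0//.
exact: lt_trans gamma_gt1.
Qed.

Let csnd (p rho a b h : R) : R := Num.sqrt (gamma * (h * a + p) / (h * b + rho)).

(** [lambda] along the line through a state with v = 0 in the direction [eigendir]: at parameter [h]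
    the velocity is (u - h la, h), the pressure p + h a and the density rho + h b. The sign [s]
    stands for (-1)^j. *)
Let lambda_line (s u p rho la a b h : R) : R :=
  let ch := csnd p rho a b h in
  ((h * - la + u) * h + s * ch *
     Num.sqrt ((h * - la + u) ^+ 2 + h ^+ 2 - ch ^+ 2)) /
  ((h * - la + u) ^+ 2 - ch ^+ 2).

(** The derivatives of the velocity u and of the sound speed at 0 are proportional to [la], hence
    carry one factor [s]. In the quotient rule each meets a second [s], and s^2 = 1, so both
    families get the same value. *)
Lemma is_derive_lambda_line (s u p rho c S : R) :
  (s = 1 \/ s = -1) -> 0 < c -> 0 < S -> 0 < rho -> 0 < u ->
  c ^+ 2 = gamma * p / rho -> S ^+ 2 = u ^+ 2 - c ^+ 2 ->
  let la := s * c / S in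
  let a := rho * (la * u) in
  is_derive (0 : R) (1 : R) (lambda_line s u p rho la a (a / c ^+ 2))
     ((gamma + 1) * u ^+ 3 / (2 * (S ^+ 2) ^+ 2)).
Proof.
move=> sE c0 S0 rho0 u0 cE SE la a.
pose uh (h : R) : R := h * - la + u.
pose ch (h : R) : R := csnd p rho a (a / c ^+ 2) h.
have dM (f g : R -> R) (x a' b' : R) : is_derive x (1 : R) f a' -> is_derive x (1 : R) g b' ->
    is_derive x (1 : R) (fun h => f h * g h) (f x * b' + g x * a').
  by move=> df dg; exact: is_deriveM.
have dD (f g : R -> R) (x a' b' : R) : is_derive x (1 : R) f a' -> is_derive x (1 : R) g b' ->
    is_derive x (1 : R) (fun h => f h + g h) (a' + b').
  by move=> df dg; exact: is_deriveD.
have dB (f g : R -> R) (x a' b' : R) : is_derive x (1 : R) f a' -> is_derive x (1 : R) g b' ->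
    is_derive x (1 : R) (fun h => f h - g h) (a' - b').
  by move=> df dg; exact: is_deriveB.
have dsqrt (f : R -> R) (x a' : R) : is_derive x (1 : R) f a' -> 0 < f x ->
    is_derive x (1 : R) (fun h => Num.sqrt (f h)) ((2 * Num.sqrt (f x))^-1 * a').
  by move=> df fx; apply: (@is_derive1_comp R Num.sqrt f x) => //; exact: is_derive1_sqrt.
have daff (k m : R) : is_derive (0 : R) (1 : R) (fun h : R => h * k + m) k.
  have := dD _ _ _ _ _ (dM _ _ _ _ _ (is_derive_id (0 : R) 1)
    (is_derive_cst k (0:R) 1)) (is_derive_cst m (0:R) 1).
  by rewrite mulr0 add0r mulr1 addr0.
have duh : is_derive (0 : R) (1 : R) uh (- la) by exact: daff.
have uh0 : uh 0 = u by rewrite /uh mul0r add0r.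
have g0 : 0 < gamma by exact: lt_trans gamma_gt1.
have p0 : 0 < p.
  have : 0 < c ^+ 2 by rewrite exprn_gt0.
  by rewrite cE pmulr_lgt0 ?invr_gt0// pmulr_rgt0.
have ch0 : ch 0 = c.
  by rewrite /ch /csnd !mul0r !add0r -cE sqrtr_sqr gtr0_norm.
have dch : is_derive (0 : R) (1 : R) ch ((gamma - 1) * la * u / (2 * c)).
  have dnum := dM _ _ _ _ _ (is_derive_cst gamma (0 : R) 1) (daff a p).
  have den0 : 0 * (a / c ^+ 2) + rho != 0 by rewrite mul0r add0r gt_eqF.
  have dden := @is_deriveV R (fun h => h * (a / c ^+ 2) + rho) _ _ _ den0 (daff _ _).
  have r0 : 0 < gamma * (0 * a + p) * (0 * (a / c ^+ 2) + rho)^-1.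
    by rewrite !mul0r !add0r -cE exprn_gt0.
  have dch := dsqrt _ _ _ (dM _ _ _ _ _ dnum dden) r0.
  rewrite /ch /csnd; apply: (is_derive_eq dch).
  rewrite [X in (2 * X)^-1]ch0 /= !mul0r !add0r.
  have -> : p = c ^+ 2 * rho / gamma by rewrite cE; field; rewrite !gt_eqF.
  rewrite /= /GRing.scale/= /a; field.
  by rewrite !gt_eqF.
pose q h := uh h ^+ 2 + h ^+ 2 - ch h ^+ 2.
have dX (f : R -> R) (x a' : R) : is_derive x (1 : R) f a' ->
    is_derive x (1 : R) (fun h => f h ^+ 2) (2 * f x * a').
  move=> df; apply: (is_derive_eq (dM _ _ _ _ _ df df)).
  by rewrite mulr_natl mulr2n mulrDl.
have du2 := dX _ _ _ duh; have dc2 := dX _ _ _ dch.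
have dh2 := dX _ _ _ (is_derive_id (0 : R) 1).
have dq := dB _ _ _ _ _ (dD _ _ _ _ _ du2 dh2) dc2.
have q0 : q 0 = S ^+ 2 by rewrite /q uh0 ch0 SE expr0n/= addr0.
have dS := dsqrt q 0 _ dq (eq_ind_r (fun x => 0 < x) (exprn_gt0 2 S0) q0).
have dN := dD _ _ _ _ _ (dM _ _ _ _ _ duh (is_derive_id (0 : R) 1))
  (dM _ _ _ _ _ (dM _ _ _ _ _ (is_derive_cst s (0:R) 1) dch) dS).
have d2 := dB _ _ _ _ _ du2 dc2.
have S2n0 : uh 0 ^+ 2 - ch 0 ^+ 2 != 0.
  by rewrite uh0 ch0 -SE gt_eqF// exprn_gt0.
have := dM _ _ _ _ _ dN (@is_deriveV R (fun h => uh h ^+ 2 - ch h ^+ 2) _ _ _ S2n0 d2).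
rewrite uh0 ch0 q0 -SE sqrtr_sqr gtr0_norm// => H.
apply: (is_derive_eq H).
(* The quotient rule yields (gamma + 1) u (S^2 + c^2) / (2 S^4), so u^3 has to be brought to the
   form u (S^2 + c^2). *)
have u2 : u ^+ 2 = S ^+ 2 + c ^+ 2 by rewrite SE subrK.
have -> : u ^+ 3 = u * (S ^+ 2 + c ^+ 2) by rewrite exprS u2.
rewrite /= /GRing.scale/= /la.
by case: sE => ->; field; rewrite !gt_eqF.
Qed.

Lemma derive_lambda j U : velv U = 0 -> supersonic gamma U ->
  'D_(eigendir gamma j U) (lambda gamma j) U =
    (gamma + 1) * velu U ^+ 3 / (2 * (velu U ^+ 2 - sound gamma U ^+ 2) ^+ 2).
Proof.
move=> v0 sU; have c0 := sound_gt0 sU; have [p0 r0 cu] := sU.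
have q0 : 0 < velu U ^+ 2 - sound gamma U ^+ 2.
  by rewrite subr_gt0 ltrXn2r// ltW// (lt_trans c0).
set S := Num.sqrt (velu U ^+ 2 - sound gamma U ^+ 2).
have S0 : 0 < S by rewrite sqrtr_gt0.
have SE : S ^+ 2 = velu U ^+ 2 - sound gamma U ^+ 2 by rewrite sqr_sqrtr// ltW.
have cE : sound gamma U ^+ 2 = gamma * pres U / dens U.
  by rewrite sqr_sqrtr// divr_ge0 ?mulr_ge0// ltW// (lt_trans _ gamma_gt1).
have sE : (-1) ^+ j = 1 :> R \/ (-1) ^+ j = -1 :> R.
  by have := signr_odd R j; case: (odd j) => <-; [right; exact: expr1|left; exact: expr0].
have laE : lambda gamma j U = (-1) ^+ j * sound gamma U / S.
  rewrite /lambda v0 mulr0 add0r expr0n/= addr0 -/S -SE.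
  by field; rewrite gt_eqF.
have u0 : 0 < velu U by apply: lt_trans cu.
have := is_derive_lambda_line sE c0 S0 r0 u0 cE SE.
rewrite /= -laE -SE => H; rewrite -(@derive_val _ _ _ _ _ _ _ H).
(* Both derivatives are limits of the same difference quotients, since [lambda] on the line is
   [lambda_line]. *)
rewrite /derive; apply: (congr1 (fun g : R -> R => lim (g @ 0^'))).
apply/funext => h /=; rewrite [h%:A]mulr1 addr0.
have E (x : R) : lambda gamma j (x *: eigendir gamma j U + U) =
    lambda_line ((-1) ^+ j) (velu U) (pres U) (dens U) (lambda gamma j U)
      (dens U * (lambda gamma j U * velu U))
      (dens U * (lambda gamma j U * velu U) / sound gamma U ^+ 2) x.
  rewrite [LHS]/lambda /sound -/(sound gamma U).
  have -> : velu (x *: eigendir gamma j U + U) = x * - lambda gamma j U + velu U.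
    by rewrite /velu !mxE.
  have -> : velv (x *: eigendir gamma j U + U) = x.
    by rewrite /velv !mxE/= mulr1 -/(velv U) v0 addr0.
  have -> : pres (x *: eigendir gamma j U + U) =
      x * (dens U * (lambda gamma j U * velu U)) + pres U.
    by rewrite /pres !mxE/= v0 subr0.
  have -> : dens (x *: eigendir gamma j U + U) =
      x * (dens U * (lambda gamma j U * velu U) / sound gamma U ^+ 2) + dens U.
    by rewrite [LHS]/dens !mxE/= v0 subr0.
  by [].
rewrite E; have := E 0; rewrite scale0r add0r => laE0.
by congr (_ *: (_ - _)).
Qed.

(** At v = 0 the two acoustic eigenvalues are opposite, while [kappa] is the same positive number
    for both families by [derive_lambda]. The signs of [k] and [b] are what invertibility and the
    reflection estimate rest on. *)
Lemma background_eigenvec U : velv U = 0 -> supersonic gamma U ->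
  exists k b : R, [/\ 0 < k, 0 < b,
    velv (eigenvec gamma 1 U) = k /\ pres (eigenvec gamma 1 U) = - b &
    velv (eigenvec gamma 4 U) = k /\ pres (eigenvec gamma 4 U) = b].
Proof.
move=> v0 sU; have c0 := sound_gt0 sU; have [p0 r0 cu] := sU.
have u0 : 0 < velu U by apply: lt_trans cu.
have q0 : 0 < velu U ^+ 2 - sound gamma U ^+ 2.
  by rewrite subr_gt0 ltrXn2r// ltW// (lt_trans c0).
set la := sound gamma U * Num.sqrt (velu U ^+ 2 - sound gamma U ^+ 2)
    / (velu U ^+ 2 - sound gamma U ^+ 2).
have la0 : 0 < la by rewrite divr_gt0// mulr_gt0// sqrtr_gt0.
pose k := (2 * (velu U ^+ 2 - sound gamma U ^+ 2) ^+ 2) /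
  ((gamma + 1) * velu U ^+ 3).
have k0 : 0 < k.
  have g0 : 0 < gamma by apply: lt_trans gamma_gt1.
  by rewrite divr_gt0// mulr_gt0// ?exprn_gt0// addr_gt0.
have kE j : kappa gamma j U = k by rewrite /kappa derive_lambda// invf_div.
have la1 : lambda gamma 1 U = - la.
  by rewrite /lambda v0 mulr0 add0r expr0n/= addr0 expr1 !mulN1r !mulNr.
have la4 : lambda gamma 4 U = la.
  have sg : (-1) ^+ 4 = 1 :> R by ring.
  by rewrite /lambda v0 mulr0 add0r expr0n/= addr0 sg mul1r.
exists k, (k * (dens U * (la * velu U))); split => //.
- exact: mulr_gt0 k0 (mulr_gt0 r0 (mulr_gt0 la0 u0)).
- by rewrite /eigenvec kE /velv /pres !mxE/= la1 v0 subr0 mulr1 mulNr !mulrN.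
- by rewrite /eigenvec kE /velv /pres !mxE/= la4 v0 subr0 mulr1.
Qed.

End BackgroundEigen.

(** * Combined vortex sheets and entropy waves as linear maps depending on their strengths *)

Section VortexSheetMap.
Context {R : realType}.

(** By the tangent inequality at both ends, the slope of the chord of the exponential lies between
    [expR t] and [expR s], and both are within [d] of [m]. *)
Lemma expR_incr_bounds (s t m d : R) :
  `|expR s - m| <= d -> `|expR t - m| <= d ->
  `|expR s - expR t - m * (s - t)| <= d * `|s - t|.
Proof.
wlog st : s t / t <= s => [H|].
  have [|/ltW ts] := leP t s; first exact: H.
  move=> Hs Ht; have := H _ _ ts Ht Hs.
  have -> : expR t - expR s - m * (t - s) = - (expR s - expR t - m * (s - t)).
    by ring.
  by rewrite normrN [`|t - s|]distrC.
have E1 : expR t * (s - t) <= expR s - expR t.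
  have := expR_ge1Dx (s - t); rewrite expRD expRN => H.
  have := ler_wpM2l (expR_ge0 t) H.
  rewrite mulrCA mulfV ?gt_eqF ?expR_gt0//; lra.
have E2 : expR s - expR t <= expR s * (s - t).
  have := expR_ge1Dx (t - s); rewrite expRD expRN => H.
  have := ler_wpM2l (expR_ge0 s) H.
  rewrite mulrCA mulfV ?gt_eqF ?expR_gt0//; lra.
have st0 : 0 <= s - t by rewrite subr_ge0.
rewrite !ler_norml => /andP[s1 s2] /andP[t1 t2].
rewrite ger0_norm// ; apply/andP; split.
  apply: (@le_trans _ _ ((expR t - m) * (s - t))); last by rewrite mulrBl lerD2r.
  by rewrite -mulNr ler_wpM2r.
apply: (@le_trans _ _ ((expR s - m) * (s - t))); first by rewrite mulrBl lerD2r.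
by rewrite ler_wpM2r.
Qed.

(** Strict differentiability of x e^s, the form of every coordinate of [G23] except the pressure. *)
Lemma mul_expR_strict (x0 s0 e : R) : 0 < e ->
  exists2 r, 0 < r & forall x x' s s' : R,
    `|x - x0| < r -> `|x' - x0| < r -> `|s - s0| < r -> `|s' - s0| < r ->
    `|x * expR s - x' * expR s' - ((x - x') * expR s0 + x0 * expR s0 * (s - s'))|
      <= e * (`|x - x'| + `|s - s'|).
Proof.
move=> e0; set m := expR s0; have m0 : 0 < m by exact: expR_gt0.
have X0 : 0 < `|x0| + m + 1 by rewrite ltr_wpDl// addr_ge0// ltW.
have [d [d0 d1 de]] : exists d, [/\ 0 < d, d <= 1 & d * (`|x0| + m + 1) <= e].
  (* The final bound has the coefficients d and d (|x0| + m + d); the condition d <= 1 puts both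
     below d (|x0| + m + 1). *)
  exists (Num.min 1 (e / (`|x0| + m + 1))).
  rewrite lt_min ltr01 divr_gt0// ge_min lexx; split => //.
  by rewrite -ler_pdivlMr// ge_min lexx orbT.
have [r r0 rP] : exists2 r, 0 < r & forall s, `|s - s0| < r -> `|expR s - m| < d.
  apply: near_normP; have := @continuous_expR R s0.
  by move/cvgrPdist_lt => /(_ _ d0); apply: filterS => s; rewrite distrC.
exists (Num.min r d); first by rewrite lt_min r0.
move=> x x' s s'; rewrite !lt_min => /andP[_ xd] /andP[_ x'd] /andP[/rP/ltW sr _].
move=> /andP[/rP/ltW s'r _].
have -> : x * expR s - x' * expR s' - ((x - x') * m + x0 * m * (s - s')) =
  (x - x') * (expR s - m) +
  (x0 * (expR s - expR s' - m * (s - s')) +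
   (x' - x0) * ((expR s - expR s' - m * (s - s')) + m * (s - s'))) by ring.
have H := expR_incr_bounds sr s'r.
have ss0 := normr_ge0 (s - s'); have xx0 := normr_ge0 (x - x').
apply: (@le_trans _ _ (`|x - x'| * d + (`|x0| * (d * `|s - s'|) +
    d * (d * `|s - s'| + m * `|s - s'|)))).
  apply: le_trans (ler_normD _ _) _; apply: lerD.
    by rewrite normrM ler_wpM2l.
  apply: le_trans (ler_normD _ _) _; apply: lerD.
    by rewrite normrM ler_wpM2l.
  rewrite normrM; apply: ler_pM; [exact: normr_ge0|exact: normr_ge0|exact: ltW x'd|].
  apply: le_trans (ler_normD _ _) _; apply: lerD => //.
  by rewrite normrM gtr0_norm.
have -> : `|x - x'| * d + (`|x0| * (d * `|s - s'|) +
    d * (d * `|s - s'| + m * `|s - s'|)) =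
   d * `|x - x'| + d * (`|x0| + m + d) * `|s - s'| by ring.
rewrite [leRHS]mulrDr; apply: lerD; apply: ler_wpM2r => //; apply: le_trans de.
  rewrite -[leLHS]mulr1; apply: ler_wpM2l; first exact: ltW.
  by rewrite lerDr addr_ge0// ltW.
by apply: ler_wpM2l; [exact: ltW|rewrite lerD2l].
Qed.

Lemma G23E s3 s2 (W : 'rV[R]_4) : G23 s3 s2 W =
  mkstate (velu W * expR s2) (velv W * expR s2) (pres W) (dens W * expR s3).
Proof. by rewrite /G23 /Phi3 /Phi2 !mkstateE. Qed.

Lemma state_coordB (U V : 'rV[R]_4) :
  (velu (U - V) = velu U - velu V) * (velv (U - V) = velv U - velv V) *
  (pres (U - V) = pres U - pres V) * (dens (U - V) = dens U - dens V).
Proof. by rewrite /velu /velv /pres /dens !mxE. Qed.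

Lemma state_coordD (U V : 'rV[R]_4) :
  (velu (U + V) = velu U + velu V) * (velv (U + V) = velv U + velv V) *
  (pres (U + V) = pres U + pres V) * (dens (U + V) = dens U + dens V).
Proof. by rewrite /velu /velv /pres /dens !mxE. Qed.

Lemma state_coordZ k (U : 'rV[R]_4) :
  (velu (k *: U) = k * velu U) * (velv (k *: U) = k * velv U) *
  (pres (k *: U) = k * pres U) * (dens (k *: U) = k * dens U).
Proof. by rewrite /velu /velv /pres /dens !mxE. Qed.

Lemma G23B s3 s2 (U V : 'rV[R]_4) : G23 s3 s2 (U - V) = G23 s3 s2 U - G23 s3 s2 V.
Proof.
by apply: stateP; rewrite !G23E !(state_coordB, mkstateE) ?mulrBl.
Qed.

Lemma G23Z s3 s2 k (U : 'rV[R]_4) : G23 s3 s2 (k *: U) = k *: G23 s3 s2 U.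
Proof.
by apply: stateP; rewrite !G23E !(state_coordZ, mkstateE) ?mulrA.
Qed.

(** Strengths of successive sheets add up; this is why the guess for the outgoing sheet is
    [s2 + a2], [s3 + a3]. *)
Lemma G23D s3 s2 t3 t2 (U : 'rV[R]_4) :
  G23 s3 s2 (G23 t3 t2 U) = G23 (s3 + t3) (s2 + t2) U.
Proof.
by apply: stateP; rewrite !G23E !mkstateE// expRD mulrAC mulrA.
Qed.

Lemma G23_le s3 s2 (U : 'rV[R]_4) :
  `|G23 s3 s2 U| <= (expR s2 + expR s3 + 1) * `|U|.
Proof.
have e2 := expR_gt0 s2; have e3 := expR_gt0 s3; have U0 := normr_ge0 U.
have H k x : 0 <= x -> `|U 0 k * x| <= x * `|U|.
  move=> x0; rewrite normrM (ger0_norm x0) mulrC.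
  by apply: ler_wpM2l => //; exact: rV_coord_le.
apply: state_norm_le; rewrite G23E mkstateE.
- apply: le_trans (H _ _ (ltW e2)) _; apply: ler_wpM2r => //; lra.
- apply: le_trans (H _ _ (ltW e2)) _; apply: ler_wpM2r => //; lra.
- apply: le_trans (rV_coord_le _ _) _; rewrite -[leLHS]mul1r.
  by apply: ler_wpM2r => //; lra.
- apply: le_trans (H _ _ (ltW e3)) _; apply: ler_wpM2r => //; lra.
Qed.

(** The differential of [G23 s3 s2 U] in the two strengths, applied to the increments [t2] and [t3].
    Its pressure component is 0, and so is its v-component when [U] has v = 0. *)
Definition vortex_dir (s3 s2 : R) (U : 'rV[R]_4) (t2 t3 : R) : 'rV[R]_4 :=
  mkstate (velu U * expR s2 * t2) (velv U * expR s2 * t2) 0 (dens U * expR s3 * t3).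

Lemma G23_strict s30 s20 (U0 : 'rV[R]_4) e : 0 < e ->
  exists2 r, 0 < r & forall s3 s2 s3' s2' W W',
    `|s3 - s30| < r -> `|s3' - s30| < r -> `|s2 - s20| < r -> `|s2' - s20| < r ->
    `|W - U0| < r -> `|W' - U0| < r ->
    `|G23 s3 s2 W - G23 s3' s2' W' -
       (G23 s30 s20 (W - W') + vortex_dir s30 s20 U0 (s2 - s2') (s3 - s3'))|
      <= e * (`|W - W'| + `|s2 - s2'| + `|s3 - s3'|).
Proof.
move=> e0.
have [ru ru0 Hu] := mul_expR_strict (velu U0) s20 e0.
have [rv rv0 Hv] := mul_expR_strict (velv U0) s20 e0.
have [rd rd0 Hd] := mul_expR_strict (dens U0) s30 e0.
exists (Num.min (Num.min ru rv) rd); first by rewrite !lt_min ru0 rv0.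
move=> s3 s2 s3' s2' W W'; rewrite !lt_min => /andP[/andP[a1 a2] a3].
move=> /andP[/andP[b1 b2] b3] /andP[/andP[c1 c2] c3] /andP[/andP[d1 d2] d3].
move=> /andP[/andP[g1 g2] g3] /andP[/andP[h1 h2] h3].
have co k (V : 'rV[R]_4) (r : R) : `|V - U0| < r -> `|V 0 k - U0 0 k| < r.
  move=> /(le_lt_trans _); apply; apply: le_trans (rV_coord_le _ k).
  by rewrite !mxE.
have coW k : `|W 0 k - W' 0 k| <= `|W - W'|.
  by apply: le_trans (rV_coord_le _ k); rewrite !mxE.
have W0 := normr_ge0 (W - W'); have s20' := normr_ge0 (s2 - s2').
have s30' := normr_ge0 (s3 - s3').
apply: state_norm_le; rewrite !(state_coordB, state_coordD) !G23E !mkstateE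
  !state_coordB.
- apply: le_trans (Hu _ _ _ _ (co _ _ _ g1) (co _ _ _ h1) c1 d1) _.
  apply: ler_wpM2l; first exact: ltW.
  by have := coW 0; rewrite /velu; lra.
- apply: le_trans (Hv _ _ _ _ (co _ _ _ g2) (co _ _ _ h2) c2 d2) _.
  apply: ler_wpM2l; first exact: ltW.
  by have := coW 1; rewrite /velv; lra.
- rewrite addr0 subrr normr0; apply: mulr_ge0; first exact: ltW.
  by rewrite !addr_ge0.
- apply: le_trans (Hd _ _ _ _ (co _ _ _ g3) (co _ _ _ h3) a3 b3) _.
  apply: ler_wpM2l; first exact: ltW.
  by have := coW 3%:R; rewrite /dens; lra.
Qed.

End VortexSheetMap.

(* Makes matrices a [completeNormedModType], as the Banach theorem requires. *)
HB.instance Definition _ (R : realType) m n := NormedModule.on 'M[R]_(m, n).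

(** * Strict derivatives: chain rule and local surjectivity *)

Section StrictlyDifferentiable.
Context {R : realType}.

(** Both points vary, so that with an invertible [L] the estimate gives injectivity near [x0] as
    well as surjectivity. Boundedness and additivity of [L] are stated separately. *)
Definition strict_diff (V W : normedModType R) (f : V -> W) (x0 : V) (L : V -> W) :=
  forall e, 0 < e -> exists2 r, 0 < r & forall x y,
    `|x - x0| < r -> `|y - x0| < r -> `|f x - f y - L (x - y)| <= e * `|x - y|.

Definition bounded_op (V W : normedModType R) (L : V -> W) :=
  exists2 C, 0 < C & forall v, `|L v| <= C * `|v|.

Lemma strict_diff_lipschitz (V W : normedModType R) (f : V -> W) x0 L :
  strict_diff f x0 L -> bounded_op L ->
  exists2 C, 0 < C & exists2 r, 0 < r & forall x y,
    `|x - x0| < r -> `|y - x0| < r -> `|f x - f y| <= C * `|x - y|.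
Proof.
move=> /(_ _ ltr01)[r r0 H] [C C0 LC]; exists (1 + C); first exact: addr_gt0.
exists r => // x y xr yr; rewrite -[f x - f y](subrK (L (x - y))) mulrDl.
by apply: le_trans (ler_normD _ _) _; apply: lerD; [exact: H|exact: LC].
Qed.

Lemma strict_diff_near (V W : normedModType R) (f : V -> W) x0 L :
  strict_diff f x0 L -> bounded_op L -> forall e, 0 < e ->
  exists2 r, 0 < r & forall x, `|x - x0| < r -> `|f x - f x0| < e.
Proof.
move=> fL bL e e0; have [C C0 [r r0 H]] := strict_diff_lipschitz fL bL.
exists (Num.min r (e / C)); first by rewrite lt_min r0 divr_gt0.
move=> x; rewrite lt_min => /andP[xr xe].
apply: le_lt_trans (H x x0 xr _) _; first by rewrite subrr normr0.
by rewrite mulrC -ltr_pdivlMr.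
Qed.

Lemma strict_diff_comp (U V W : normedModType R) (f : U -> V) (g : V -> W) x0 L K :
  strict_diff f x0 L -> bounded_op L ->
  strict_diff g (f x0) K -> bounded_op K ->
  (forall a b, K (a - b) = K a - K b) ->
  strict_diff (g \o f) x0 (K \o L).
Proof.
move=> fL bL gK [D D0 KD] Ka e e0.
have [C C0 [r1 r10 fC]] := strict_diff_lipschitz fL bL.
have e1 : 0 < e / 2 / C by rewrite !divr_gt0.
have e2 : 0 < e / 2 / D by rewrite !divr_gt0.
have [r2 r20 gr] := gK _ e1.
have [r3 r30 fr] := fL _ e2.
have [r4 r40 fn] := strict_diff_near fL bL r20.
exists (Num.min (Num.min r1 r3) r4); first by rewrite !lt_min r10 r30.
move=> x y; rewrite !lt_min => /andP[/andP[x1 x3] x4] /andP[/andP[y1 y3] y4] /=.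
have -> : g (f x) - g (f y) - K (L (x - y)) =
    (g (f x) - g (f y) - K (f x - f y)) + K (f x - f y - L (x - y)).
  by rewrite [K (_ - L _)]Ka addrA subrK.
have -> : e * `|x - y| = e / 2 / C * (C * `|x - y|) + D * (e / 2 / D * `|x - y|).
  by field; rewrite !gt_eqF.
apply: le_trans (ler_normD _ _) _; apply: lerD.
  apply: le_trans (gr _ _ (fn _ x4) (fn _ y4)) _.
  by apply: ler_wpM2l; [exact: ltW|exact: fC].
apply: le_trans (KD _) _; apply: ler_wpM2l; first exact: ltW.
exact: fr.
Qed.

Lemma bounded_op_comp (U V W : normedModType R) (L : U -> V) (K : V -> W) :
  bounded_op L -> bounded_op K -> bounded_op (K \o L).
Proof.
move=> [C C0 LC] [D D0 KD]; exists (D * C); first exact: mulr_gt0.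
move=> v /=; apply: le_trans (KD _) _; rewrite -mulrA.
by apply: ler_wpM2l; [exact: ltW|exact: LC].
Qed.

Lemma mulmx_bounded n (B : 'M[R]_n) : bounded_op (fun v : 'rV[R]_n => v *m B).
Proof.
exists (1 + n%:R * `|B|); first by rewrite ltr_pwDl// mulr_ge0.
move=> v; apply: rV_norm_le => [|i]; first by rewrite !mulr_ge0// addr_ge0// mulr_ge0.
rewrite mxE; apply: le_trans (ler_norm_sum _ _ _) _.
apply: (@le_trans _ _ (\sum_(k < n) `|v| * `|B|)).
  apply: ler_sum => k _; rewrite normrM; apply: ler_pM; [by []|by []|exact: rV_coord_le|].
  rewrite [leRHS]/Num.Def.normr/= mx_normrE.
  exact: (le_bigmax _ (fun i : 'I_n * 'I_n => `|B i.1 i.2|) (k, i)).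
rewrite sumr_const card_ord -[leLHS]mulr_natl mulrCA mulrC.
by apply: ler_wpM2r => //; rewrite lerDr.
Qed.

(* Newton-type iteration [d |-> d - (f d - z) A^-1], a contraction near [d0]. *)
Lemma strict_diff_surj n (f : 'rV[R]_n -> 'rV[R]_n) d0 (A : 'M[R]_n) c rho r :
  A \in unitmx -> 0 < c -> (forall v : 'rV[R]_n, `|v *m invmx A| <= c * `|v|) ->
  0 < rho -> rho < r ->
  (forall x y, `|x - d0| < r -> `|y - d0| < r ->
     `|f x - f y - (x - y) *m A| <= (2 * c)^-1 * `|x - y|) ->
  forall z, `|f d0 - z| <= rho / (2 * c) ->
  exists2 d, `|d - d0| <= rho & f d = z.
Proof.
move=> uA c0 Hc rho0 rhor H z Hz.
pose T d := d - (f d - z) *m invmx A.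
pose D := [set d : 'rV[R]_n | `|d - d0| <= rho].
(* [T x - T y] is minus the linearization error of [f] times A^-1, whence the contraction factor c /
   (2 c) = 1/2. *)
have TT x y : `|x - d0| <= rho -> `|y - d0| <= rho -> `|T x - T y| <= 2^-1 * `|x - y|.
  move=> xr yr.
  have -> : T x - T y = - ((f x - f y - (x - y) *m A) *m invmx A).
    have E : (f x - f y) *m invmx A = (f x - z) *m invmx A - (f y - z) *m invmx A.
      by rewrite -mulmxBl opprB subrKA.
    rewrite /T [in RHS]mulmxBl mulmxK// E opprB !opprB -!addrA; congr (x + _).
    by rewrite addrCA [RHS]addrCA; congr (_ + _); rewrite addrC.
  rewrite normrN; apply: le_trans (Hc _) _.
  have -> : 2^-1 * `|x - y| = c * ((2 * c)^-1 * `|x - y|) by field; rewrite gt_eqF.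
  apply: ler_wpM2l; first exact: ltW.
  by apply: H; [exact: le_lt_trans rhor|exact: le_lt_trans rhor].
(* Half of the radius pays for the contraction, the other half for |T d0 - d0| <= c rho / (2 c). *)
have TD : {homo T : x / D x >-> D x}.
  move=> x Dx; rewrite /D /=.
  have D0 : `|d0 - d0| <= rho by rewrite subrr normr0 ltW.
  rewrite -[T x](subrK (T d0)) -addrA; apply: le_trans (ler_normD _ _) _.
  rewrite [rho]splitr; apply: lerD.
    apply: le_trans (TT _ _ Dx D0) _; rewrite mulrC.
    by apply: ler_wpM2r.
  rewrite /T addrAC subrr add0r normrN; apply: le_trans (Hc _) _.
  have -> : rho / 2 = c * (rho / (2 * c)) by field; rewrite gt_eqF.
  by apply: ler_wpM2l; first exact: ltW.
have cD : closed D.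
  rewrite (_ : D = closed_ball d0 rho); first exact: closed_ball_closed.
  by rewrite closed_ballE//; apply/seteqP; split => x; rewrite /D /closed_ball_/= distrC.
have D0 : D d0 by rewrite /D /= subrr normr0 ltW.
have half0 : 0 <= 2^-1 :> R by rewrite invr_ge0.
have ctr : is_contraction [fun of mkfun TD].
  exists (NngNum half0); split => /=; first by rewrite invf_lt1// ltr1n.
  by move=> [x y] [/= Dx Dy]; exact: TT.
have [d Dd] := banach_fixed_point ctr cD (ex_intro _ _ D0).
rewrite /= /mkfun /T => dE; exists d => //.
have BE : (f d - z) *m invmx A = 0.
  by apply: oppr_inj; apply: (addrI d); rewrite oppr0 addr0 -dE.
apply/eqP; rewrite -subr_eq0; apply/eqP.
by rewrite -[LHS](mulmxKV uA) BE mul0mx.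
Qed.

End StrictlyDifferentiable.

(** * Differential of the strong-wave map, its injectivity and the reflection coefficient *)

Section StrongCombination.
Context {R : realType}.
Variable gamma : R.

Lemma pair_norm_lt (V W : normedModType R) (x : V * W) (e : R) :
  `|x| < e -> `|x.1| < e /\ `|x.2| < e.
Proof. by rewrite prod_normE gt_max => /andP. Qed.

(** Each wave is written as a map of pairs (strengths, state) that keeps the strengths and updates
    the state. The three waves then act on one space and can be chained by [strict_diff_comp]. *)
Lemma strict_wave j Phi (U0 d0 : 'rV[R]_4) k :
  lax_curve gamma j Phi U0 -> d0 0 k = 0 ->
  strict_diff (fun x : 'rV[R]_4 * 'rV[R]_4 => (x.1, Phi (x.1 0 k) x.2)) (d0, U0)
    (fun v => (v.1, v.1 0 k *: eigenvec gamma j U0 + v.2)).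
Proof.
move=> lax dk e e0; have e20 : 0 < e / 2 by rewrite divr_gt0.
have [r r0 H] := lax_curve_strict lax e20; exists r => // x y.
move=> /pair_norm_lt[/= x1 x2] /pair_norm_lt[/= y1 y2].
have co z : `|z - d0| < r -> `|z 0 k| < r.
  move=> /(le_lt_trans _); apply; apply: le_trans (rV_coord_le _ k).
  by rewrite !mxE dk subr0.
have xy1 : `|x.1 - y.1| <= `|x - y| by rewrite [leRHS]prod_normE le_max lexx.
have xy2 : `|x.2 - y.2| <= `|x - y| by rewrite [leRHS]prod_normE le_max lexx orbT.
have coxy : `|x.1 0 k - y.1 0 k| <= `|x - y|.
  by apply: le_trans xy1; apply: le_trans (rV_coord_le _ k); rewrite !mxE.
rewrite prod_normE ge_max/= subrr normr0; apply/andP; split.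
  by apply: mulr_ge0; [exact: ltW|exact: normr_ge0].
have -> : (x.1 - y.1) 0 k = x.1 0 k - y.1 0 k by rewrite !mxE.
apply: le_trans (H _ _ _ _ (co _ x1) (co _ y1) x2 y2) _.
have -> : e * `|x - y| = e / 2 * (`|x - y| + `|x - y|) by field.
by apply: ler_wpM2l; [exact: ltW|apply: lerD].
Qed.

Lemma bounded_wave (w : 'rV[R]_4) k :
  bounded_op (fun v : 'rV[R]_4 * 'rV[R]_4 => (v.1, v.1 0 k *: w + v.2)).
Proof.
exists (`|w| + 1) => [|v]; first exact: ltr_wpDl.
have v1 : `|v.1| <= `|v| by rewrite prod_normE le_max lexx.
have v2 : `|v.2| <= `|v| by rewrite prod_normE le_max lexx orbT.
rewrite prod_normE ge_max/= mulrDl mul1r; apply/andP; split.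
  by apply: le_trans v1 _; rewrite lerDr mulr_ge0.
apply: le_trans (ler_normD _ _) _; apply: lerD => //.
rewrite normrZ mulrC; apply: ler_wpM2l => //.
exact: le_trans (rV_coord_le _ _) v1.
Qed.

Lemma strict_vortex (U0 d0 : 'rV[R]_4) :
  strict_diff (fun x : 'rV[R]_4 * 'rV[R]_4 => (x.1, G23 (x.1 0 2%:R) (x.1 0 1) x.2))
    (d0, U0)
    (fun v => (v.1, G23 (d0 0 2%:R) (d0 0 1) v.2 +
      vortex_dir (d0 0 2%:R) (d0 0 1) U0 (v.1 0 1) (v.1 0 2%:R))).
Proof.
move=> e e0; have e30 : 0 < e / 3 by rewrite divr_gt0.
have [r r0 H] := G23_strict (d0 0 2%:R) (d0 0 1) U0 e30; exists r => // x y.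
move=> /pair_norm_lt[/= x1 x2] /pair_norm_lt[/= y1 y2].
have co z k : `|z - d0| < r -> `|z 0 k - d0 0 k| < r.
  move=> /(le_lt_trans _); apply; apply: le_trans (rV_coord_le _ k).
  by rewrite !mxE.
have xy1 : `|x.1 - y.1| <= `|x - y| by rewrite [leRHS]prod_normE le_max lexx.
have xy2 : `|x.2 - y.2| <= `|x - y| by rewrite [leRHS]prod_normE le_max lexx orbT.
have coxy k : `|x.1 0 k - y.1 0 k| <= `|x - y|.
  by apply: le_trans xy1; apply: le_trans (rV_coord_le _ k); rewrite !mxE.
rewrite prod_normE ge_max/= subrr normr0; apply/andP; split.
  by apply: mulr_ge0; [exact: ltW|exact: normr_ge0].
have mxB k : (x.1 - y.1) 0 k = x.1 0 k - y.1 0 k by rewrite !mxE.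
rewrite !mxB.
apply: le_trans (H _ _ _ _ _ _ (co _ _ x1) (co _ _ y1) (co _ _ x1) (co _ _ y1) x2 y2) _.
have -> : e * `|x - y| = e / 3 * (`|x - y| + `|x - y| + `|x - y|) by field.
apply: ler_wpM2l; first exact: ltW.
by apply: lerD; [apply: lerD|].
Qed.

Lemma bounded_vortex (U0 : 'rV[R]_4) s3 s2 :
  bounded_op (fun v : 'rV[R]_4 * 'rV[R]_4 => (v.1, G23 s3 s2 v.2 +
      vortex_dir s3 s2 U0 (v.1 0 1) (v.1 0 2%:R))).
Proof.
pose c := expR s2 + expR s3 + 1.
have c1 : 1 <= c.
  by have := expR_gt0 s2; have := expR_gt0 s3; rewrite /c; lra.
exists (c + c * `|U0|) => [|v].
  by apply: ltr_wpDr; [rewrite mulr_ge0// (le_trans _ c1)|exact: lt_le_trans c1].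
have v1 : `|v.1| <= `|v| by rewrite prod_normE le_max lexx.
have v2 : `|v.2| <= `|v| by rewrite prod_normE le_max lexx orbT.
have c0 : 0 <= c by apply: le_trans c1.
have cU : 0 <= c * `|U0| by rewrite mulr_ge0.
rewrite prod_normE ge_max/= mulrDl; apply/andP; split.
  apply: le_trans v1 _; apply: (@le_trans _ _ (c * `|v|)).
    by rewrite -[leLHS]mul1r; apply: ler_wpM2r.
  by rewrite lerDl mulr_ge0.
apply: le_trans (ler_normD _ _) _; apply: lerD.
  by apply: le_trans (G23_le _ _ _) _; apply: ler_wpM2l.
have H k x l : 0 <= x -> x <= c -> `|U0 0 k * x * v.1 0 l| <= c * `|U0| * `|v|.
  move=> x0 xc; rewrite normrM; apply: ler_pM; [by []|by []| |].
    rewrite normrM mulrC; apply: ler_pM; [by []|by []|by rewrite ger0_norm|].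
    exact: rV_coord_le.
  exact: le_trans (rV_coord_le _ _) v1.
have e2 := expR_gt0 s2; have e3 := expR_gt0 s3.
by apply: state_norm_le; rewrite mkstateE; [apply: H|apply: H| |apply: H];
  rewrite /c ?normr0 ?mulr_ge0//; lra.
Qed.

Lemma vortex_dirB s3 s2 (U0 : 'rV[R]_4) t2 t2' t3 t3' :
  vortex_dir s3 s2 U0 (t2 - t2') (t3 - t3') =
  vortex_dir s3 s2 U0 t2 t3 - vortex_dir s3 s2 U0 t2' t3'.
Proof.
by apply: stateP; rewrite !(state_coordB, mkstateE) ?mulrBr// subrr.
Qed.

Definition strong_map (Phi1 Phi4 : R -> 'rV[R]_4 -> 'rV[R]_4) (d U : 'rV[R]_4) :=
  Phi4 (d 0 3%:R) (G23 (d 0 2%:R) (d 0 1) (Phi1 (d 0 0) U)).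

(** The differential of [strong_map] in the strengths at the background: [r1] is taken below the
    sheet and carried across it by [G23], whereas [r4] is already taken above. *)
Definition strong_deriv (r1 r4 U0 : 'rV[R]_4) s3 s2 (v : 'rV[R]_4) :=
  v 0 3%:R *: r4 + (G23 s3 s2 (v 0 0 *: r1) +
     vortex_dir s3 s2 U0 (v 0 1) (v 0 2%:R)).

(** The chain rule is applied to strengths and state jointly. For two points with the same lower
    state the state increment is 0, which leaves the derivative in the strengths, uniformly in that
    state. *)
Lemma strong_map_strict Phi1 Phi4 (U0 d0 : 'rV[R]_4) :
  d0 0 0 = 0 -> d0 0 3%:R = 0 ->
  lax_curve gamma 1 Phi1 U0 ->
  lax_curve gamma 4 Phi4 (G23 (d0 0 2%:R) (d0 0 1) U0) ->
  forall e, 0 < e -> exists2 r, 0 < r & forall d d' U,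
    `|d - d0| < r -> `|d' - d0| < r -> `|U - U0| < r ->
    `|strong_map Phi1 Phi4 d U - strong_map Phi1 Phi4 d' U -
      strong_deriv (eigenvec gamma 1 U0)
        (eigenvec gamma 4 (G23 (d0 0 2%:R) (d0 0 1) U0)) U0
        (d0 0 2%:R) (d0 0 1) (d - d')| <= e * `|d - d'|.
Proof.
move=> d00 d03 lax1 lax4 e e0.
have [r1 r10 id1] := lax_curve_id lax1.
have idU : Phi1 0 U0 = U0 by apply: id1; rewrite subrr normr0.
have s1 := strict_wave lax1 d00.
have b1 := bounded_wave (eigenvec gamma 1 U0) 0.
have s2 := strict_vortex U0 d0.
have b2 := bounded_vortex U0 (d0 0 2%:R) (d0 0 1).
have s3 := strict_wave lax4 d03.
have b3 := bounded_wave (eigenvec gamma 4 (G23 (d0 0 2%:R) (d0 0 1) U0)) 3%:R.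
have s21 := strict_diff_comp (g := fun x : 'rV[R]_4 * 'rV[R]_4 =>
  (x.1, G23 (x.1 0 2%:R) (x.1 0 1) x.2)) s1 b1.
rewrite /= d00 idU in s21; have {}s21 := s21 _ s2 b2.
have s321 := strict_diff_comp (g := fun x : 'rV[R]_4 * 'rV[R]_4 =>
  (x.1, Phi4 (x.1 0 3%:R) x.2)) (s21 _) (bounded_op_comp b1 b2).
rewrite /= d00 idU in s321; have {}s321 := s321 _ _ s3 b3.
have [||r r0 H] := s321 _ _ e e0.
- move=> a b; apply: injective_projections => //=.
  have mxB k : (a.1 - b.1) 0 k = a.1 0 k - b.1 0 k by rewrite !mxE.
  by rewrite !mxB vortex_dirB G23B opprD addrACA.
- move=> a b; apply: injective_projections => //=.
  by rewrite !mxE scalerBl opprD addrACA.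
exists r => // d d' U dr d'r Ur.
have := H (d, U) (d', U); rewrite !prod_normE/=. rewrite [U - U]subrr addr0.
rewrite !gt_max dr d'r Ur => /(_ isT isT); rewrite ge_max => /andP[_].
rewrite normr0 [Num.max `|_| 0]max_l//; exact: le_trans.
Qed.

Lemma strong_deriv_linear (r1 r4 U0 : 'rV[R]_4) s3 s2 :
  linear (strong_deriv r1 r4 U0 s3 s2).
Proof.
move=> k a b; apply: stateP;
  rewrite /strong_deriv !(G23E, state_coordD, state_coordZ, mkstateE) !mxE; ring.
Qed.

Lemma strong_deriv_mx (r1 r4 U0 : 'rV[R]_4) s3 s2 :
  exists A : 'M[R]_4, forall v, strong_deriv r1 r4 U0 s3 s2 v = v *m A.
Proof.
pose f : {linear _ -> _} := HB.pack (strong_deriv r1 r4 U0 s3 s2)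
  (GRing.isLinear.Build _ _ _ _ _ (strong_deriv_linear r1 r4 U0 s3 s2)).
by exists (lin1_mx f) => v; rewrite mul_rV_lin1.
Qed.

Hypothesis gamma_gt1 : 1 < gamma.
Variables (Um1 : 'rV[R]_4) (s20 s30 : R).
Let Um2 := G23 s30 s20 Um1.
Hypothesis Um1_v0 : velv Um1 = 0.
Hypothesis Um1_supersonic : supersonic gamma Um1.
Hypothesis Um2_supersonic : supersonic gamma Um2.
Let L := strong_deriv (eigenvec gamma 1 Um1) (eigenvec gamma 4 Um2) Um1 s30 s20.

(** As v = 0 at the background, the sheet directions contribute nothing to the (v, p)-components,
    which form a 2 by 2 system in [v 0 0] and [v 0 3]. Once these vanish, the u- and rho-components
    kill the other two strengths. *)
Lemma strong_deriv_inj v : L v = 0 -> v = 0.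
Proof.
have Um2_v0 : velv Um2 = 0 by rewrite /Um2 G23E mkstateE Um1_v0 mul0r.
have [k1 [b1 [k10 b10 [r1v r1p] _]]] := background_eigenvec gamma_gt1 Um1_v0 Um1_supersonic.
have [k2 [b2 [k20 b20 _ [r4v r4p]]]] := background_eigenvec gamma_gt1 Um2_v0 Um2_supersonic.
have [p0 rho0 cu] := Um1_supersonic.
have u0 : 0 < velu Um1 := lt_trans (sound_gt0 gamma_gt1 Um1_supersonic) cu.
have e2 := expR_gt0 s20; have e3 := expR_gt0 s30.
rewrite /L; move: (eigenvec gamma 1 Um1) (eigenvec gamma 4 Um2) r1v r1p r4v r4p.
move=> r1 r4 r1v r1p r4v r4p Lv.
have co U : U = 0 :> 'rV[R]_4 ->
    (velu U = 0) * (velv U = 0) * (pres U = 0) * (dens U = 0).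
  by move=> ->; rewrite /velu /velv /pres /dens !mxE.
move/co: Lv; rewrite /strong_deriv !(G23E, state_coordD, state_coordZ, mkstateE).
rewrite Um1_v0 r1v r1p r4v r4p !mul0r !addr0 => -[[[Eu Ev] Ep] Ed].
(* The determinant of that system, a sum of two positive terms. *)
have D0 : expR s20 * k1 * b2 + b1 * k2 != 0.
  by rewrite gt_eqF// addr_gt0// !mulr_gt0.
have v0 : v 0 0 = 0.
  apply: (mulIf D0); rewrite mul0r.
  have -> : v 0 0 * (expR s20 * k1 * b2 + b1 * k2) =
    b2 * (v 0 3%:R * k2 + v 0 0 * k1 * expR s20) - k2 * (v 0 3%:R * b2 + v 0 0 * - b1).
    by ring.
  by rewrite Ev Ep !mulr0 subrr.
have v3 : v 0 3%:R = 0.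
  move: Ep; rewrite v0 mul0r addr0 => /eqP; rewrite mulf_eq0 (gt_eqF b20) orbF.
  by move=> /eqP.
rewrite v0 v3 !mul0r !add0r in Eu Ed.
apply: stateP; rewrite /velu /velv /pres /dens !mxE//.
- move/eqP : Eu; rewrite !mulf_eq0 (gt_eqF u0) (gt_eqF e2)/= => /eqP//.
- move/eqP : Ed; rewrite !mulf_eq0 (gt_eqF rho0) (gt_eqF e3)/= => /eqP//.
Qed.

(** The 1- and 4-eigenvectors at [Um1] share [k1] and [b1], so the (v, p)-part of the right-hand
    side is (e^s20 k1, b1). Cramer's rule gives (P - Q) / (P + Q) with P = e^s20 k1 b2 and Q = b1
    k2. *)
Lemma reflection_lt1 v : L v = G23 s30 s20 (eigenvec gamma 4 Um1) -> `|v 0 0| < 1.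
Proof.
have Um2_v0 : velv Um2 = 0 by rewrite /Um2 G23E mkstateE Um1_v0 mul0r.
have [k1 [b1 [k10 b10 [r1v r1p] [r41v r41p]]]] :=
  background_eigenvec gamma_gt1 Um1_v0 Um1_supersonic.
have [k2 [b2 [k20 b20 _ [r4v r4p]]]] := background_eigenvec gamma_gt1 Um2_v0 Um2_supersonic.
have e2 := expR_gt0 s20.
rewrite /L; move: (eigenvec gamma 1 Um1) (eigenvec gamma 4 Um1)
  (eigenvec gamma 4 Um2) r1v r1p r41v r41p r4v r4p.
move=> r1 r41 r4 r1v r1p r41v r41p r4v r4p Lv.
have co (U V : 'rV[R]_4) : U = V -> (velv U = velv V) * (pres U = pres V).
  by move=> ->.
move/co: Lv; rewrite /strong_deriv !(G23E, state_coordD, state_coordZ, mkstateE).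
rewrite Um1_v0 r1v r1p r4v r4p r41v r41p !mul0r !addr0 => -[Ev Ep].
have A0 : 0 < expR s20 * k1 * b2 by rewrite !mulr_gt0.
have B0 : 0 < b1 * k2 by rewrite mulr_gt0.
have E : v 0 0 * (expR s20 * k1 * b2 + b1 * k2) = expR s20 * k1 * b2 - b1 * k2.
  have -> : v 0 0 * (expR s20 * k1 * b2 + b1 * k2) =
    b2 * (v 0 3%:R * k2 + v 0 0 * k1 * expR s20) - k2 * (v 0 3%:R * b2 + v 0 0 * - b1).
    by ring.
  by rewrite Ev Ep; ring.
have AB0 : 0 < expR s20 * k1 * b2 + b1 * k2 by rewrite addr_gt0.
rewrite -[v 0 0](mulfK (lt0r_neq0 AB0)) E normrM normfV (gtr0_norm AB0).
by rewrite ltr_pdivrMr// mul1r ltr_norml; apply/andP; split; lra.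
Qed.

End StrongCombination.

(** * The residual of the explicit guess for the outgoing strengths *)

Section Residual.
Context {R : realType}.

(** Turns an inequality into the exact form with coefficients [K] and [E]. Both terms of the bound
    [s] are scaled by the same fraction [t / s], and [Num.sg a] changes [|a|] into a multiple of
    [a]; if [s] is 0, so is [t]. *)
Lemma split_bound (t a D k m : R) : 0 <= k -> 0 <= m -> 0 <= D ->
  `|t| <= k * `|a| + m * D ->
  exists K E, [/\ t = K * a + E * D, `|K| <= k & `|E| <= m].
Proof.
move=> k0 m0 D0 tb; set s := k * `|a| + m * D.
have [s0|s0] := eqVneq s 0.
  exists 0, 0; rewrite !mul0r addr0 normr0; split=> //.
  by apply/eqP; rewrite -normr_le0 -s0.
have sp : 0 < s by rewrite lt_def s0 /s addr_ge0// mulr_ge0.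
have th1 : `|t / s| <= 1 by rewrite normrM normfV (gtr0_norm sp) ler_pdivrMr// mul1r.
exists (t / s * k * Num.sg a), (t / s * m); split.
- have -> : t / s * k * Num.sg a * a + t / s * m * D =
      t / s * (k * (Num.sg a * a) + m * D) by ring.
  by rewrite -normrEsg divfK.
- rewrite normrM -[leRHS]mulr1; apply: ler_pM => //.
    by rewrite normrM (ger0_norm k0) -[leRHS]mul1r; apply: ler_wpM2r.
  by rewrite normr_sg; case: (a != 0).
- by rewrite normrM (ger0_norm m0) -[leRHS]mul1r; apply: ler_wpM2r.
Qed.

(** Inserting the bound on [y] brings [n] to the right with factor t <= 1/2; moving it to the left
    costs a factor 2. *)
Lemma absorb_bound (n y a x t D : R) : 0 <= n -> 0 <= t -> t <= 2^-1 -> 0 <= a ->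
  y <= a * x + n -> n <= t * (y + a) + D -> n <= t * (2 * x + 3) * a + 2 * D.
Proof.
move=> n0 t0 t2 a0 yn nt.
have h1 : t * (y + a) <= t * (a * x + n + a) by apply: ler_wpM2l => //; lra.
have h2 : t * n <= 2^-1 * n by apply: ler_wpM2r.
have h3 : 0 <= t * a by rewrite mulr_ge0.
lra.
Qed.

(** Follows from |e^a - 1| <= 2 |a| for small a. It is the source of the factor |a2| + |a3| in the
    quadratic error. *)
Lemma G23_near_id : exists2 r : R, 0 < r & forall a3 a2 (y : 'rV[R]_4),
  `|a3| < r -> `|a2| < r -> `|G23 a3 a2 y - y| <= 2 * (`|a2| + `|a3|) * `|y|.
Proof.
have [r r0 H] : exists2 r, 0 < r & forall a : R, `|a - 0| < r -> `|expR a - 1| < 1.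
  apply: near_normP; have := @continuous_expR R 0.
  move=> /cvgrPdist_lt/(_ _ ltr01); apply: filterS => s.
  by rewrite /= expR0 distrC.
have H2 (a : R) : `|a| < r -> `|expR a - 1| <= 2 * `|a|.
  move=> ar; have /H/ltW h : `|a - 0| < r by rewrite subr0.
  have h0 : `|expR 0 - 1| <= 1 :> R by rewrite expR0 subrr normr0.
  have := expR_incr_bounds h h0; rewrite expR0 subr0 mul1r => h1.
  rewrite -[expR a - 1](subrK a); apply: le_trans (ler_normD _ _) _.
  by rewrite mulr_natl mulr2n lerD2r -[leRHS]mul1r.
exists r => // a3 a2 y a3r a2r.
have b2 := H2 _ a2r; have b3 := H2 _ a3r.
have co k (x : R) c : `|x - 1| <= 2 * c -> 0 <= c -> c <= `|a2| + `|a3| ->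
    `|y 0 k * x - y 0 k| <= 2 * (`|a2| + `|a3|) * `|y|.
  move=> xc c0 ca; rewrite -[X in _ - X]mulr1 -mulrBr normrM mulrC.
  apply: ler_pM; [by []|by []| |exact: rV_coord_le].
  by apply: le_trans xc _; apply: ler_wpM2l.
apply: state_norm_le; rewrite state_coordB G23E mkstateE.
- by apply: co b2 _ _ => //; rewrite lerDl.
- by apply: co b2 _ _ => //; rewrite lerDl.
- by rewrite subrr normr0 !mulr_ge0// addr_ge0.
- by apply: co b3 _ _ => //; rewrite lerDr.
Qed.

Variables (gamma : R) (Phi1 Phi4 : R -> 'rV[R]_4 -> 'rV[R]_4).
Variables (Um1 : 'rV[R]_4) (s20 s30 : R).
Hypothesis lax1 : lax_curve gamma 1 Phi1 Um1.
Hypothesis lax4 : lax_curve gamma 4 Phi4 Um1.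

Let c0 := expR s20 + expR s30 + 1.
Let c0_gt0 : 0 < c0.
Proof. by rewrite !addr_gt0 ?expR_gt0. Qed.

Lemma lax_curve_near j Phi (U0 : 'rV[R]_4) : lax_curve gamma j Phi U0 ->
  exists2 C, 0 < C & exists2 r, 0 < r & forall t U,
    `|t| < r -> `|U - U0| < r -> `|Phi t U - U| <= C * `|t|.
Proof.
move=> lax; have [r1 r10 H1] := lax_curve_strict lax ltr01.
have [r2 r20 H2] := lax_curve_id lax.
exists (`|eigenvec gamma j U0| + 1); first exact: ltr_wpDl.
exists (Num.min r1 r2); first by rewrite lt_min r10.
move=> t U; rewrite !lt_min => /andP[t1 _] /andP[U1 U2].
have zr : `|0 : R| < r1 by rewrite normr0.
have := H1 _ _ _ _ t1 zr U1 U1.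
rewrite H2// !subr0 subrr normr0 !addr0 mul1r => h.
rewrite -[Phi t U - U](subrK (t *: eigenvec gamma j U0)).
apply: le_trans (ler_normD _ _) _; rewrite mulrDl mul1r addrC; apply: lerD => //.
by rewrite normrZ mulrC.
Qed.

(** Keeps the state reached after the sheet in the neighborhood of the upper background state on
    which [Phi4 0] is the identity. *)
Lemma vortex_state_near e : 0 < e ->
  exists2 r, 0 < r & forall b s3 s2 U,
    `|b| < r -> `|s3 - s30| < r -> `|s2 - s20| < r -> `|U - Um1| < r ->
    `|G23 s3 s2 (Phi1 b U) - G23 s30 s20 Um1| < e.
Proof.
move=> e0; have [C C0 [r1 r10 H1]] := lax_curve_near lax1.
have [r2 r20 H2] := G23_near_id.
pose N := c0 * (C + 1) + 4 * c0 * (`|Um1| + C + 1) + 1.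
have N0 : 0 < N.
  have h1 : 0 <= c0 * (C + 1) by rewrite mulr_ge0 ?ltW// addr_gt0.
  have h2 : 0 <= 4 * c0 * (`|Um1| + C + 1).
    by rewrite !mulr_ge0 ?addr_ge0// ltW.
  by rewrite /N; lra.
have : \forall r \near (0 : R)^'+, [/\ 0 < r, r < 1, r < r1, r < r2 & r * N < e].
  near=> r; split; [by near: r; exact: nbhs_right_gt| | | |].
  - by near: r; exact: nbhs_right_lt.
  - by near: r; exact: nbhs_right_lt.
  - by near: r; exact: nbhs_right_lt.
  - by rewrite -ltr_pdivlMr//; near: r; apply: nbhs_right_lt; rewrite divr_gt0.
move=> /filter_ex[r [r0 rl rr1 rr2 rN]].
exists r => // b s3 s2 U br s3r s2r Ur.
have W1 : `|Phi1 b U - Um1| <= r * (C + 1).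
  rewrite -[Phi1 b U - Um1](subrKA U); apply: le_trans (ler_normD _ _) _.
  rewrite mulrDr mulr1; apply: lerD; last exact: ltW.
  apply: le_trans (H1 _ _ (lt_trans br rr1) (lt_trans Ur rr1)) _.
  by rewrite mulrC; apply: ler_wpM2r; exact: ltW.
set W := Phi1 b U in W1 *.
(* The strong sheet is factored into the background sheet followed by a weak one, to which
   [G23_near_id] applies. *)
have -> : G23 s3 s2 W = G23 (s3 - s30) (s2 - s20) (G23 s30 s20 W).
  by rewrite G23D !subrK.
have WU : `|W| <= `|Um1| + C + 1.
  rewrite -[W](subrK Um1); apply: le_trans (ler_normD _ _) _.
  rewrite addrC -addrA lerD2l; apply: le_trans W1 _.
  by rewrite -[leRHS]mul1r; apply: ler_wpM2r; [rewrite ltW// addr_gt0|exact: ltW].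
have SW : `|G23 s30 s20 W| <= c0 * (`|Um1| + C + 1).
  by apply: le_trans (G23_le _ _ _) _; apply: ler_wpM2l; [exact: ltW|].
have E1 := H2 _ _ (G23 s30 s20 W) (lt_trans s3r rr2) (lt_trans s2r rr2).
have E2 : `|G23 s30 s20 W - G23 s30 s20 Um1| <= c0 * (r * (C + 1)).
  by rewrite -G23B; apply: le_trans (G23_le _ _ _) _; apply: ler_wpM2l; [exact: ltW|].
apply: le_lt_trans rN.
rewrite -[X in `|X|](subrKA (G23 s30 s20 W)); apply: le_trans (ler_normD _ _) _.
have E1' : 2 * (`|s2 - s20| + `|s3 - s30|) * `|G23 s30 s20 W| <=
    4 * r * (c0 * (`|Um1| + C + 1)).
  by apply: ler_pM => //; lra.
apply: le_trans (lerD (le_trans E1 E1') E2) _.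
have -> : r * N = 4 * r * (c0 * (`|Um1| + C + 1)) + c0 * (r * (C + 1)) + r.
  by rewrite /N; ring.
by rewrite lerDl ltW.
Unshelve. all: by end_near. Qed.

(** Going through the intermediate state [V = G23 a3 a2 U1], the difference splits into the effect
    of the weak 4-wave and the commutator of [Phi1 b] with [G23 a3 a2]. The constant [C] comes
    before [e]: the error linear in [a4] can be made small without changing it. *)
Lemma residual_bound : exists2 C, 0 < C & forall e, 0 < e ->
  exists2 r, 0 < r & forall U1 a2 a3 a4 b s2 s3,
    `|U1 - Um1| < r -> `|a2| < r -> `|a3| < r -> `|a4| < r -> `|b| < r ->
    `|s2 - s20| < r -> `|s3 - s30| < r ->
    `|G23 s3 s2 (Phi1 b (Phi4 a4 (G23 a3 a2 U1))) -
      G23 (s3 + a3) (s2 + a2) (Phi1 b U1) -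
      a4 *: G23 s30 s20 (eigenvec gamma 4 Um1)|
    <= e * `|a4| + C * (`|b| * (`|a2| + `|a3|)).
Proof.
have [C1 C10 [r1 r10 H1]] := lax_curve_near lax1.
have [C4 C40 [r4 r40 H4]] := lax_curve_near lax4.
have [r2 r20 H2] := G23_near_id.
have [Cm Cm0 [rm rm0 Hm]] := lax_curve_mixed lax1.
have [ri ri0 Hi1] := lax_curve_id lax1.
have [rj rj0 Hi4] := lax_curve_id lax4.
(* [5 * c0] bounds [G23 s3 s2] as an operator; the [Cm] term comes from [lax_curve_mixed] and the
   [C1] term from [G23 a3 a2] minus the identity. *)
exists (5 * c0 * (Cm * (2 * (`|Um1| + 1)) + 2 * C1)).
  rewrite !mulr_gt0//; apply: ltr_wpDl; last by rewrite mulr_gt0.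
  by rewrite !mulr_ge0// addr_ge0.
move=> e e0; set w := eigenvec gamma 4 Um1.
(* The coefficients of [e / N * |a4|] produced below by [B1] and [B2] sum to N - 1. *)
pose N := 5 * c0 * (C4 + 1) + 4 * (c0 * `|w|) + 1.
have cw0 : 0 <= c0 * `|w| by rewrite mulr_ge0// ltW.
have cC0 : 0 < c0 * (C4 + 1) by rewrite mulr_gt0// addr_gt0.
have N0 : 0 < N by rewrite /N; lra.
have e1 : 0 < e / N by rewrite divr_gt0.
have [rs1 rs10 Hs1] := lax_curve_strict lax1 e1.
have [rs4 rs40 Hs4] := lax_curve_strict lax4 e1.
(* When the data are within [r], the intermediate states [V] and [X] are within [r * P] of [Um1]. *)
pose P := 4 * (`|Um1| + 1) + C4 + 2.
have P0 : 0 < P by have := normr_ge0 Um1; rewrite /P; lra.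
have lt_ex : forall t : R, 0 < t -> \forall r \near (0 : R)^'+, r * P < t.
  by move=> t t0; near=> r; rewrite -ltr_pdivlMr//; near: r;
    apply: nbhs_right_lt; rewrite divr_gt0.
have : \forall r \near (0 : R)^'+, [/\ 0 < r, r < 1, r <= e / N & True] /\
   [/\ r * P < r1, r * P < r4, r * P < r2 & r * P < rm] /\
   [/\ r * P < ri, r * P < rj, r * P < rs1 & r * P < rs4].
  near=> r; split; [split|split; split]; try (by near: r; exact: lt_ex).
  - by near: r; exact: nbhs_right_gt.
  - by near: r; exact: nbhs_right_lt.
  - by near: r; exact: nbhs_right_le.
  - by [].
move=> /filter_ex[r [[r0 rl re _] [[q1 q4 q2 qm] [qi qj qs1 qs4]]]].
have P1 : 1 <= P by have := normr_ge0 Um1; rewrite /P; lra.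
have rP : r <= r * P by rewrite -[leLHS]mulr1; apply: ler_wpM2l => //; exact: ltW.
exists r => // U1 a2 a3 a4 b s2 s3 U1r a2r a3r a4r br s2r s3r.
have big (x t : R) : r * P < t -> x < r -> x < t.
  by move=> rt xr; apply: lt_trans xr _; exact: le_lt_trans rt.
set V := G23 a3 a2 U1.
have U1n : `|U1| <= `|Um1| + 1.
  rewrite -[U1](subrK Um1) addrC; apply: le_trans (ler_normD _ _) _.
  by rewrite lerD2l ltW// (lt_trans U1r).
set q := `|a2| + `|a3|; have q0 : 0 <= q by rewrite addr_ge0.
have VU1 : `|V - U1| <= 2 * q * (`|Um1| + 1).
  apply: le_trans (H2 _ _ U1 (big _ _ q2 a3r) (big _ _ q2 a2r)) _.
  by apply: ler_wpM2l; rewrite ?mulr_ge0.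
have q2r : q <= 2 * r by rewrite /q; lra.
have VU1' : `|V - U1| <= r * (4 * (`|Um1| + 1)).
  apply: le_trans VU1 _; rewrite mulrA; apply: ler_wpM2r; [exact: addr_ge0|lra].
have VU : `|V - Um1| <= r * (4 * (`|Um1| + 1) + 1).
  rewrite -[V - Um1](subrKA U1); apply: le_trans (ler_normD _ _) _.
  by rewrite mulrDr mulr1; apply: lerD => //; exact: ltW.
have VP : `|V - Um1| <= r * P.
  apply: le_trans VU _; apply: ler_wpM2l; [exact: ltW|by rewrite /P; lra].
set X := Phi4 a4 V.
have XV : `|X - V| <= C4 * `|a4|.
  by apply: H4; [exact: big q4 a4r|exact: le_lt_trans q4].
have XP : `|X - Um1| <= r * P.
  rewrite -[X - Um1](subrKA V); apply: le_trans (ler_normD _ _) _.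
  have : C4 * `|a4| <= C4 * r by apply: ler_wpM2l; exact: ltW.
  move=> h; apply: le_trans (lerD (le_trans XV h) VU) _; rewrite /P; lra.
(* The 5 is 1 for the background sheet plus 4 for the deviation of the weak factor from the
   identity, as r < 1. *)
have S_le y : `|G23 s3 s2 y| <= 5 * c0 * `|y|.
  have -> : G23 s3 s2 y = G23 (s3 - s30) (s2 - s20) (G23 s30 s20 y).
    by rewrite G23D !subrK.
  have h := H2 _ _ (G23 s30 s20 y) (big _ _ q2 s3r) (big _ _ q2 s2r).
  have h' : 2 * (`|s2 - s20| + `|s3 - s30|) * `|G23 s30 s20 y| <=
      4 * `|G23 s30 s20 y| by apply: ler_wpM2r => //; lra.
  have h0 : `|G23 s30 s20 y| <= c0 * `|y| := G23_le s30 s20 y.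
  rewrite -[G23 _ _ (G23 _ _ _)](subrK (G23 s30 s20 y)).
  apply: le_trans (ler_normD _ _) _.
  apply: le_trans (lerD (le_trans h h') (lexx _)) _; lra.
have S_w : `|G23 s3 s2 w - G23 s30 s20 w| <= 4 * (e / N) * (c0 * `|w|).
  have -> : G23 s3 s2 w = G23 (s3 - s30) (s2 - s20) (G23 s30 s20 w).
    by rewrite G23D !subrK.
  have h := H2 _ _ (G23 s30 s20 w) (big _ _ q2 s3r) (big _ _ q2 s2r).
  apply: le_trans h _; apply: ler_pM; [|by []| |exact: G23_le].
    by rewrite mulr_ge0// addr_ge0.
  by lra.
(* With equal strengths [b], [Phi1] acts on differences almost as the identity, and [X - V] is
   [a4 *: w] to first order. *)
have T1 : `|Phi1 b X - Phi1 b V - a4 *: w| <= e / N * (C4 + 1) * `|a4|.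
  have h1 := Hs1 _ _ _ _ (big _ _ qs1 br) (big _ _ qs1 br)
    (le_lt_trans XP qs1) (le_lt_trans VP qs1).
  have z4 : `|0 : R| < rs4 by rewrite normr0.
  have h2 := Hs4 _ _ _ _ (big _ _ qs4 a4r) z4
    (le_lt_trans VP qs4) (le_lt_trans VP qs4).
  rewrite Hi4 ?(le_lt_trans VP)// !subrr subr0 normr0 !addr0 -/X -/w in h2.
  rewrite !subrr scale0r normr0 !add0r in h1.
  rewrite -[Phi1 b X - Phi1 b V - a4 *: w](subrKA (X - V)).
  apply: le_trans (ler_normD _ _) _.
  apply: le_trans (lerD h1 h2) _.
  have : e / N * `|X - V| <= e / N * (C4 * `|a4|).
    by apply: ler_wpM2l => //; exact: ltW.
  by lra.
(* The commutator: one part is the mixed estimate with [V - U1] of size |a2| + |a3|, the other is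
   [G23 a3 a2] minus the identity applied to a vector of size |b|. *)
have T3 : `|Phi1 b V - G23 a3 a2 (Phi1 b U1)| <=
    (Cm * (2 * (`|Um1| + 1)) + 2 * C1) * (`|b| * q).
  have idV : Phi1 0 V = V by apply: Hi1; exact: le_lt_trans qi.
  have idU1 : Phi1 0 U1 = U1 by apply: Hi1; exact: big qi U1r.
  have h1 := Hm _ _ _ (big _ _ qm br) (le_lt_trans VP qm) (big _ _ qm U1r).
  rewrite idV idU1 in h1.
  have h2 := H2 _ _ (Phi1 b U1 - U1) (big _ _ q2 a3r) (big _ _ q2 a2r).
  have h3 := H1 _ _ (big _ _ q1 br) (big _ _ q1 U1r).
  have -> : Phi1 b V - G23 a3 a2 (Phi1 b U1) =
      (Phi1 b V - V - (Phi1 b U1 - U1)) -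
      (G23 a3 a2 (Phi1 b U1 - U1) - (Phi1 b U1 - U1)).
    have subCC (x y z : 'rV[R]_4) : (x - y) - (z - y) = x - z.
      by rewrite opprB subrKA.
    by rewrite subCC G23B -/V subCC.
  apply: le_trans (ler_normB _ _) _.
  have h1' : Cm * `|b| * `|V - U1| <= Cm * `|b| * (2 * q * (`|Um1| + 1)).
    by apply: ler_wpM2l => //; rewrite mulr_ge0.
  have h2' : 2 * q * `|Phi1 b U1 - U1| <= 2 * q * (C1 * `|b|).
    by apply: ler_wpM2l => //; rewrite mulr_ge0.
  apply: le_trans (lerD (le_trans h1 h1') (le_trans h2 h2')) _; lra.
have -> : G23 s3 s2 (Phi1 b X) - G23 (s3 + a3) (s2 + a2) (Phi1 b U1) -
    a4 *: G23 s30 s20 w =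
    G23 s3 s2 (Phi1 b X - Phi1 b V - a4 *: w) +
    a4 *: (G23 s3 s2 w - G23 s30 s20 w) +
    G23 s3 s2 (Phi1 b V - G23 a3 a2 (Phi1 b U1)).
  rewrite !G23B G23Z G23D scalerBr.
  by rewrite subrKA [RHS]addrAC subrKA.
have B1 : `|G23 s3 s2 (Phi1 b X - Phi1 b V - a4 *: w)| <=
    5 * c0 * (e / N * (C4 + 1) * `|a4|).
  by apply: le_trans (S_le _) _; apply: ler_wpM2l => //; rewrite mulr_ge0// ltW.
have B2 : `|a4 *: (G23 s3 s2 w - G23 s30 s20 w)| <=
    `|a4| * (4 * (e / N) * (c0 * `|w|)).
  by rewrite normrZ; apply: ler_wpM2l.
have B3 : `|G23 s3 s2 (Phi1 b V - G23 a3 a2 (Phi1 b U1))| <=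
    5 * c0 * ((Cm * (2 * (`|Um1| + 1)) + 2 * C1) * (`|b| * q)).
  by apply: le_trans (S_le _) _; apply: ler_wpM2l => //; rewrite mulr_ge0// ltW.
apply: le_trans (ler_normD _ _) _; rewrite [leRHS]addrC addrC.
rewrite -[5 * c0 * _ * _]mulrA; apply: lerD => //.
apply: le_trans (ler_normD _ _) _; apply: le_trans (lerD B1 B2) _.
have -> : 5 * c0 * (e / N * (C4 + 1) * `|a4|) +
    `|a4| * (4 * (e / N) * (c0 * `|w|)) = e / N * `|a4| * (N - 1).
  by rewrite /N; ring.
have -> : e * `|a4| = e / N * `|a4| * N by field; rewrite gt_eqF.
by apply: ler_wpM2l; [rewrite mulr_ge0// ltW|lra].
Unshelve. all: by end_near. Qed.

End Residual.

(** * Existence, uniqueness and expansion of the outgoing strengths *)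

Theorem proposition4p2 (R : realType) (gamma : R) (gamma_gt1 : 1 < gamma)
  (Phi1 Phi4 : R -> 'rV[R]_4 -> 'rV[R]_4)
  (Um1 Um2 : 'rV[R]_4) (s20 s30 : R)
  (Um1_v0 : velv Um1 = 0) (Um1_supersonic : supersonic gamma Um1)
  (Um2_v0 : velv Um2 = 0) (Um2_supersonic : supersonic gamma Um2)
  (Um12 : Um2 = G23 s30 s20 Um1)
  (Phi1_lax1 : lax_curve gamma 1 Phi1 Um1)
  (Phi1_lax2 : lax_curve gamma 1 Phi1 Um2)
  (Phi4_lax1 : lax_curve gamma 4 Phi4 Um1)
  (Phi4_lax2 : lax_curve gamma 4 Phi4 Um2) :
  exists2 M : R, 0 < M &
  \forall eta \near 0^'+, \forall eps \near 0^'+,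
  forall (U1 U2 U3 : 'rV[R]_4) (a2 a3 a4 b1 s2 s3 : R),
    ball Um1 eps U1 -> ball Um1 eps U2 -> ball Um2 eps U3 ->
    weak_waves Phi1 Phi4 eta U1 U2 (0, a2, a3, a4) ->
    strong_waves Phi1 Phi4 s20 s30 eta U2 U3 (b1, s2, s3, 0) ->
    exists d1 s2' s3' d4 : R,
      unique (strong_waves Phi1 Phi4 s20 s30 eta U1 U3) (d1, s2', s3', d4) /\
      exists K1 K2 K3 K4 E1 E2 E3 E4 : R,
        let Delta := `|b1| * (`|a2| + `|a3|) in
        [/\ [/\ d1 = b1 + K1 * a4 + E1 * Delta,
                s2' = s2 + a2 + K2 * a4 + E2 * Delta,
                s3' = s3 + a3 + K3 * a4 + E3 * Delta &
                d4 = K4 * a4 + E4 * Delta],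
            [/\ `|E1| <= M, `|E2| <= M, `|E3| <= M & `|E4| <= M],
            `|K1| < 1 &
            `|K2| + `|K3| + `|K4| <= M].
Proof.
(* Here [mkstate] only builds a row vector: the background strengths, not a state. *)
set d0 := mkstate 0 s20 s30 0 : 'rV[R]_4.
have d00 : d0 0 0 = 0 by rewrite !mxE.
have d01 : d0 0 1 = s20 by rewrite !mxE.
have d02 : d0 0 2%:R = s30 by rewrite !mxE.
have d03 : d0 0 3%:R = 0 by rewrite !mxE.
rewrite Um12 in Um2_v0 Um2_supersonic Phi1_lax2 Phi4_lax2 *.
set F := strong_map Phi1 Phi4.
have [A AE] := strong_deriv_mx (eigenvec gamma 1 Um1)
  (eigenvec gamma 4 (G23 s30 s20 Um1)) Um1 s30 s20.
have uA : A \in unitmx.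
  rewrite -row_free_unit; apply: inj_row_free => v; rewrite -AE.
  exact: strong_deriv_inj.
have [cB cB0 HB] := mulmx_bounded (invmx A).
set w := G23 s30 s20 (eigenvec gamma 4 Um1).
(* The first-order response of the four strengths to a unit of [a4]; its first entry is the
   reflection coefficient. *)
pose X := w *m invmx A.
have X1 : `|X 0 0| < 1.
  apply: (reflection_lt1 gamma_gt1 Um1_v0 Um1_supersonic Um2_supersonic).
  by rewrite AE mulmxKV.
have [C C0 HC] := residual_bound s20 s30 Phi1_lax1 Phi4_lax1.
(* Chosen so that the error linear in [a4] uses up half of the gap between [|X 0 0|] and 1. *)
pose e := (1 - `|X 0 0|) / (2 * cB * (2 * `|X| + 3)).
have X30 : 0 < 2 * `|X| + 3 by rewrite ltr_wpDl// mulr_ge0.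
have e0 : 0 < e by rewrite divr_gt0 ?subr_gt0// !mulr_gt0.
have eP : [/\ cB * e * (2 * `|X| + 3) = (1 - `|X 0 0|) / 2,
    cB * e <= 2^-1 & e <= (2 * cB)^-1].
  have eX : cB * e * (2 * `|X| + 3) = (1 - `|X 0 0|) / 2.
    by rewrite /e; field; rewrite !gt_eqF.
  have eB2 : cB * e <= 2^-1.
    have h1 := normr_ge0 (X 0 0).
    have h2 : cB * e * 3 <= cB * e * (2 * `|X| + 3).
      by apply: ler_wpM2l; [rewrite ltW// mulr_gt0|rewrite lerDr mulr_ge0].
    by lra.
  by split => //; rewrite invfM -ler_pdivrMr ?invr_gt0// invrK mulrC.
have [rF rF0 HF] : exists2 r, 0 < r & forall d d' U,
    `|d - d0| < r -> `|d' - d0| < r -> `|U - Um1| < r ->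
    `|F d U - F d' U - (d - d') *m A| <= e * `|d - d'|.
  have := strong_map_strict d00 d03 Phi1_lax1.
  rewrite d01 d02 => /(_ _ Phi4_lax2 _ e0)[r r0 H]; exists r => // d d' U dr d'r Ur.
  by rewrite -AE; exact: H.
have [rC rC0 {}HC] := HC _ e0.
have [r1 r10 Hi1] := lax_curve_id Phi1_lax1.
have [r4 r40 Hi4] := lax_curve_id Phi4_lax2.
have [rv rv0 Hv] := vortex_state_near s20 s30 Phi1_lax1 r40.
(* Room for three coefficients [K] of size |X| + 1 each, and for the coefficients [E], bounded by 2
   cB C. *)
pose M := 3 * `|X| + 3 + 2 * cB * C + 1.
have cBC0 : 0 < 2 * cB * C by rewrite !mulr_gt0.
exists M; first by have := normr_ge0 X; rewrite /M; lra.
near=> eta.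
have eta0 : 0 < eta by near: eta; exact: nbhs_right_gt.
have eF : 2 * eta < rF.
  by rewrite -ltr_pdivlMl//; near: eta; apply: nbhs_right_lt; rewrite mulr_gt0.
have eC : eta < rC by near: eta; exact: nbhs_right_lt.
have ev : 2 * eta < rv.
  by rewrite -ltr_pdivlMl//; near: eta; apply: nbhs_right_lt; rewrite mulr_gt0.
near=> eps.
have eps0 : 0 < eps by near: eps; exact: nbhs_right_gt.
have epse : eps < eta by near: eps; exact: nbhs_right_lt.
have eps1 : eps < r1 by near: eps; exact: nbhs_right_lt.
(* At the background strengths the target is missed by at most this left-hand side, while Newton's
   iteration in a ball of radius eta / 2 tolerates the right-hand side. *)
have epsS : true /\ eps * (expR s20 + expR s30 + 1 + 1) <= eta / 2 / (2 * cB).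
  split=> //.
  rewrite -ler_pdivlMr; last by rewrite !addr_gt0 ?expR_gt0.
  near: eps; apply: nbhs_right_le.
  by rewrite !divr_gt0 ?mulr_gt0// !addr_gt0 ?expR_gt0.
move=> U1 U2 U3 a2 a3 a4 b1 s2 s3; rewrite -!ball_normE /=.
rewrite ![`|_ - U1|]distrC ![`|_ - U2|]distrC ![`|_ - U3|]distrC => U1e U2e U3e.
move=> [_ a2e a3e a4e U2E] [b1e s2e s3e _ U3E].
have idU1 : Phi1 0 U1 = U1 by apply: Hi1; exact: lt_trans eps1.
rewrite /wave_comp idU1 -/(G23 a3 a2 U1) in U2E.
have add2 (x y : R) : x < eta -> y < eta -> x + y < 2 * eta.
  by move=> xe ye; rewrite mulr_natl mulr2n ltrD.
have etaD : eta < 2 * eta by rewrite mulr_natl mulr2n ltrDl.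
have half_lt (x : R) : x <= eta / 2 -> x < eta.
  by move=> /le_lt_trans; apply; rewrite gtr_pMr// invf_lt1// ltr1n.
have etaF : eta < rF := lt_trans etaD eF.
have lt2 (x : R) : x < eta -> x < rv.
  by move=> /lt_trans; apply; exact: lt_trans ev.
have {}U3E : U3 = G23 s3 s2 (Phi1 b1 U2).
  rewrite U3E Hi4//; apply: Hv; try exact: lt2.
  by apply: lt2; exact: lt_trans epse.
(* The sums [s2 + a2] and [s3 + a3] may be up to 2 eta from the background, so the guess may leave
   the parameter box of size eta; it stays within [rF]. *)
pose ds := mkstate b1 (s2 + a2) (s3 + a3) 0 : 'rV[R]_4.
have UrF : `|U1 - Um1| < rF := lt_trans (lt_trans U1e epse) etaF.
have dsF : `|ds - d0| < rF.
  apply: le_lt_trans eF; apply: state_norm_le; rewrite state_coordB !mkstateE.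
  - by rewrite subr0 ltW// (lt_trans b1e).
  - by rewrite addrAC; apply: le_trans (ler_normD _ _) _; rewrite ltW ?add2.
  - by rewrite addrAC; apply: le_trans (ler_normD _ _) _; rewrite ltW ?add2.
  - by rewrite subrr normr0 ltW// (lt_trans eta0).
have FE d U : F d U = Phi4 (d 0 3%:R) (G23 (d 0 2%:R) (d 0 1) (Phi1 (d 0 0) U)) by [].
have dsE : F ds U1 = G23 (s3 + a3) (s2 + a2) (Phi1 b1 U1).
  rewrite FE !mxE/= Hi4//; apply: Hv; last exact/lt2/(lt_trans U1e).
  - exact: lt2.
  - by rewrite addrAC; apply: le_lt_trans (ler_normD _ _) (lt_trans _ ev); apply: add2.
  - by rewrite addrAC; apply: le_lt_trans (ler_normD _ _) (lt_trans _ ev); apply: add2.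
have dvec x1 x2 x3 x4 : `|x1| < eta -> `|x2 - s20| < eta -> `|x3 - s30| < eta ->
    `|x4| < eta -> `|mkstate x1 x2 x3 x4 - d0| < rF.
  move=> h1 h2 h3 h4; apply: le_lt_trans etaF.
  by apply: state_norm_le; rewrite state_coordB !mkstateE ?subr0 ltW.
(* Radius eta / 2 places the solution strictly inside the parameter box. *)
have [d de dF] : exists2 d, `|d - d0| <= eta / 2 & F d U1 = U3.
  apply: (@strict_diff_surj R 4 (F^~ U1) d0 A cB (eta / 2) rF uA cB0) => //.
  - by rewrite divr_gt0.
  - by apply: lt_trans etaF; exact: half_lt.
  - move=> x y xr yr; apply: le_trans (HF _ _ _ xr yr UrF) _.
    by apply: ler_wpM2r => //; case: eP.
  have Fd0 : F d0 U1 = G23 s30 s20 U1.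
    rewrite FE d00 d01 d02 d03 idU1 Hi4//.
    have := @Hv 0 s30 s20 U1; rewrite idU1 !subrr normr0; apply=> //.
    exact/lt2/(lt_trans U1e).
  apply: le_trans epsS.2; rewrite Fd0 mulrDr mulr1.
  rewrite -[_ - U3](subrKA (G23 s30 s20 Um1)).
  apply: le_trans (ler_normD _ _) _; apply: lerD; last by rewrite distrC ltW.
  rewrite -G23B; apply: le_trans (G23_le _ _ _) _; rewrite mulrC.
  by apply: ler_wpM2r; [rewrite !addr_ge0 ?expR_ge0|exact: ltW].
have dr : `|d - d0| < rF := lt_trans (half_lt _ de) etaF.
have dco k : `|d 0 k - d0 0 k| < eta.
  apply: le_lt_trans (half_lt _ de).
  by apply: le_trans (rV_coord_le _ k); rewrite !mxE.
exists (d 0 0), (d 0 1), (d 0 2%:R), (d 0 3%:R); split.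
  split.
    split; last by rewrite -dF FE.
    - by have := dco 0; rewrite d00 subr0.
    - by have := dco 1; rewrite d01.
    - by have := dco 2%:R; rewrite d02.
    - by have := dco 3%:R; rewrite d03 subr0.
  move=> [[[x1 x2] x3] x4] [h1 h2 h3 h4 xE].
  pose x := mkstate x1 x2 x3 x4 : 'rV[R]_4.
  have xr : `|x - d0| < rF by exact: dvec.
  have Fx : F x U1 = U3 by rewrite FE !mxE/= xE.
  (* Two solutions have equal images, so the strict estimate leaves |d - x| <= cB e |d - x|, at most
     half of |d - x|. *)
  have := HF _ _ _ dr xr UrF; rewrite dF Fx subrr add0r normrN => h.
  have dx : d = x.
    apply/eqP; rewrite -subr_eq0 -normr_le0.
    have h5 : `|d - x| <= cB * (e * `|d - x|).
      rewrite -[in leLHS](mulmxK uA (d - x)); apply: le_trans (HB _) _.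
      by apply: ler_wpM2l; [exact: ltW|exact: h].
    have h6 : cB * (e * `|d - x|) <= 2^-1 * `|d - x|.
      by rewrite mulrA; apply: ler_wpM2r => //; case: eP.
    have h7 := le_trans h5 h6; clear - h7; lra.
  by rewrite dx !mxE.
set Delta := `|b1| * (`|a2| + `|a3|).
have Delta0 : 0 <= Delta by rewrite mulr_ge0// addr_ge0.
pose y := d - ds.
(* Multiplied by [A], the error [y - a4 *: X] is minus the linearization error of [F] between [d]
   and [ds], plus the residual of the guess. *)
have yA : `|y - a4 *: X| <= cB * (e * `|y| + (e * `|a4| + C * Delta)).
  rewrite -[y - _](mulmxK uA); apply: le_trans (HB _) _.
  apply: ler_wpM2l; first exact: ltW.
  have -> : (y - a4 *: X) *m A = - (F d U1 - F ds U1 - y *m A) +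
      (U3 - F ds U1 - a4 *: w).
    rewrite dF mulmxBl -scalemxAl mulmxKV// opprB addrA subrK.
    by [].
  apply: le_trans (ler_normD _ _) _; rewrite normrN; apply: lerD.
    exact: HF.
  rewrite U3E dsE U2E; apply: HC;
    (exact: lt_trans (lt_trans U1e epse) eC || exact: lt_trans eC).
have D0 := normr_ge0 (y - a4 *: X).
have y0 := normr_ge0 y; have a40 := normr_ge0 a4; have X0 := normr_ge0 X.
have aX : `|a4 *: X| = `|a4| * `|X| by rewrite normrZ.
have yle : `|y| <= `|a4| * `|X| + `|y - a4 *: X|.
  by rewrite -aX -[in leLHS](subrK (a4 *: X) y) addrC; exact: ler_normD.
have [eX eB2 _] := eP.
have cBe0 : 0 <= cB * e by rewrite ltW// mulr_gt0.
have yX : `|y - a4 *: X| <= (1 - `|X 0 0|) / 2 * `|a4| + 2 * cB * C * Delta.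
  rewrite -eX -[2 * cB * C]mulrA -[2 * _ * Delta]mulrA.
  apply: (absorb_bound D0 cBe0 eB2 a40 yle); apply: le_trans yA _.
  by clear; lra.
have yk k x : `|X 0 k| + (1 - `|X 0 0|) / 2 <= x ->
    `|y 0 k| <= x * `|a4| + 2 * cB * C * Delta.
  move=> Xx.
  have yE (p q : 'rV[R]_4) : p 0 k = a4 * q 0 k + (p - a4 *: q) 0 k.
    by rewrite !mxE; ring.
  rewrite (yE y X).
  apply: le_trans (ler_normD _ _) _; rewrite normrM.
  apply: le_trans (lerD (lexx _) (le_trans (rV_coord_le _ k) yX)) _.
  rewrite addrA [`|a4| * _]mulrC -mulrDl lerD2r.
  by apply: ler_wpM2r.
have [X01 K0 K1] : [/\ (1 + `|X 0 0|) / 2 < 1, 0 <= (1 + `|X 0 0|) / 2 & 0 <= `|X| + 1].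
  have h := normr_ge0 (X 0 0); clear - h X1 X0; split; lra.
have Xk k : `|X 0 k| + (1 - `|X 0 0|) / 2 <= `|X| + 1.
  have h1 := rV_coord_le X k; have h2 := normr_ge0 (X 0 0).
  by clear - h1 h2; lra.
(* For the first strength |X 0 0| plus half of the gap is (1 + |X 0 0|) / 2, still below 1; the
   other strengths only need |X| + 1. *)
have y0le : `|y 0 0| <= (1 + `|X 0 0|) / 2 * `|a4| + 2 * cB * C * Delta.
  by apply: yk; clear; lra.
have [k1 [e1 [yE1 k1b e1b]]] := split_bound K0 (ltW cBC0) Delta0 y0le.
have [k2 [e2 [yE2 k2b e2b]]] := split_bound K1 (ltW cBC0) Delta0 (yk _ _ (Xk 1)).
have [k3 [e3 [yE3 k3b e3b]]] := split_bound K1 (ltW cBC0) Delta0 (yk _ _ (Xk 2%:R)).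
have [k4 [e4 [yE4 k4b e4b]]] := split_bound K1 (ltW cBC0) Delta0 (yk _ _ (Xk 3%:R)).
exists k1, k2, k3, k4, e1, e2, e3, e4; rewrite /= -/Delta.
have yd k : d 0 k = ds 0 k + y 0 k.
  have dq (p q : 'rV[R]_4) : p 0 k = q 0 k + (p - q) 0 k by rewrite !mxE; ring.
  exact: dq.
have eM : 2 * cB * C <= M by rewrite /M; clear - X0; lra.
split.
- split; rewrite yd ?yE1 ?yE2 ?yE3 ?yE4 mxE/= ?addrA//.
  by rewrite add0r.
- by split; apply: le_trans eM.
- exact: le_lt_trans X01.
- by rewrite /M; clear - k2b k3b k4b cBC0; lra.
Unshelve. all: by end_near. Qed.
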